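(* Let $\nu\in\mathbb{R}\setminus\{0,-1,-2,\dots\}$. Then for each $n\in\mathbb{N}=\{1,2,\dots\}$, $$\Delta_n=\frac{\nu^2\, q_{n+1,\nu}(1/\nu)\,q_{n+2,\nu}(1/\nu)}{2^{n^2-2}\,(\nu+1)^{2n-1}(\nu+2)^{2n-3}\cdots(\nu+n-1)^3(\nu+n)},$$ where the product in the denominator is $\prod_{i=1}^{n}(\nu+i)^{2(n-i)+1}$.
   Context: $J_\nu$ is the Bessel function of the first kind and $J_\nu'$ its derivative in $x$. For $\nu\in\mathbb{R}\setminus\{0,-1,-2,\dots\}$ the function $$2^\nu\Gamma(\nu)x^{1-\nu}J_\nu'(x)=\sum_{k=0}^\infty \frac{(-1)^k(\nu/2+1)_k}{k!\,4^k(\nu/2)_k(\nu+1)_k}x^{2k}=:\sum_{n\ge0}c_nx^n$$ is an even entire function with value $1$ at $0$, where $(a)_k=\Gamma(a+k)/\Gamma(a)$ is the Pochhammer symbol (with $(\nu/2+1)_k/(\nu/2)_k=(\nu+2k)/\nu$). For integers $m\ge2$, the Rayleigh-type sum $\sigma_\nu'(m)$ is the sum of $\zeta^{-m}$ over all zeros $\zeta$ of this entire function, counted with multiplicity (for $\nu>0$ this is $\sum_{k\in\mathbb{Z}\setminus\{0\}}(j'_{\nu,k})^{-m}$, where $j'_{\nu,1}<j'_{\nu,2}<\cdots$ are the positive zeros of $J_\nu'$ and $j'_{\nu,-k}=-j'_{\nu,k}$). Equivalently, $\sigma'_\nu(m)=(-1)^m\det A$, where $A$ is the $m\times m$ matrix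 with first column $(c_1,2c_2,\dots,mc_m)^T$ and, for columns $j\ge2$, entries $A_{i,j}=c_{i-j+1}$ (with $c_l=0$ for $l<0$). The Hankel determinant is $\Delta_n=\det\big(\mu_{i+j-2}\big)_{1\le i,j\le n+1}$ with $\mu_l=\sigma_\nu'(l+2)$ for $l\ge0$. The polynomials $q_{n,\nu}$ are defined by $q_{0,\nu}(x)=1$, $q_{1,\nu}(x)=x/2$ and $q_{n+1,\nu}(x)=x\,q_{n,\nu}(x)-\beta_n q_{n-1,\nu}(x)$ for $n\ge1$, where $\beta_n=\frac{1}{4(\nu+n-1)(\nu+n)}$. *)

(* Defs.v *)
From HB Require Import structures.
From mathcomp Require Import all_boot all_order all_algebra.
From mathcomp Require Import finmap.
From mathcomp Require Import all_classical all_reals all_analysis.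
From mathcomp Require Import complex.

Set Implicit Arguments.
Unset Strict Implicit.
Unset Printing Implicit Defensive.

Import Order.TTheory GRing.Theory Num.Theory.
Import numFieldNormedType.Exports.

Local Open Scope classical_set_scope.
Local Open Scope ring_scope.
Local Open Scope complex_scope.

(* (a)_k = a (a + 1) ... (a + k - 1), which is Gamma (a + k) / Gamma a whenever
   a is not a pole of Gamma *)
Definition pochhammer (R : pzRingType) (a : R) (k : nat) : R :=
  \prod_(i < k) (a + i%:R).

Section EntireFunction.
Variables (R : realType) (nu : R).

Definition dbessel_coef (k : nat) : R :=
  (- 1) ^+ k * pochhammer (nu / 2 + 1) k /
  (k`!%:R * 4 ^+ k * pochhammer (nu / 2) k * pochhammer (nu + 1) k).

(* The entire function 2 ^ nu Gamma(nu) x ^ (1 - nu) J_nu'(x), given by its power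
   series; J_nu is the Bessel function of the first kind *)
Definition dbessel (x : R[i]) : R[i] :=
  limn (series (fun k => (dbessel_coef k)%:C * x ^+ (2 * k) : R[i]^o)).

End EntireFunction.

Section ZeroSums.
Variable R : realType.

(* The derivatives are complex: R[i]^o is R[i] as a normed space over itself *)
Definition order_of_zero (f : R[i] -> R[i]^o) (z : R[i]) : nat :=
  xget 0%N [set n | (forall i, (i < n)%N -> derive1n i f z = 0) /\
                    derive1n n f z <> 0].

(* Convergence along the net of finite subsets of A *)
Definition has_unordered_sum (I : choiceType) (A : set I) (F : I -> R[i])
    (s : R[i]) : Prop :=
  forall e : R, 0 < e ->
    exists2 S0 : {fset I}, [set` S0] `<=` A &
      forall S : {fset I}, (S0 `<=` S)%fset -> [set` S] `<=` A ->
        `|\sum_(i <- S) F i - s| < e%:C.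

Definition unordered_sum (I : choiceType) (A : set I) (F : I -> R[i]) : R[i] :=
  xget 0 [set s | has_unordered_sum A F s].

Definition rayleigh (nu : R) (m : nat) : R[i] :=
  unordered_sum [set z | dbessel nu z = 0]
    (fun z => z ^- m *+ order_of_zero (dbessel nu) z).

Definition hankel_det (nu : R) (n : nat) : R[i] :=
  \det (\matrix_(i < n.+1, j < n.+1) rayleigh nu (i + j + 2)).

End ZeroSums.

Section OrthogonalPolynomials.
Variables (R : realType) (nu : R).

Definition q_beta (n : nat) : R :=
  1 / (4 * (nu + n%:R - 1) * (nu + n%:R)).

Fixpoint q_poly (n : nat) : {poly R} :=
  match n with
  | 0 => 1
  | n1.+1 =>
      match n1 with
      | 0 => 2^-1 *: 'X
      | n2.+1 => 'X * q_poly n1 - q_beta n1 *: q_poly n2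
      end
  end.

End OrthogonalPolynomials.

(* Main.v *)
(* The theorem has an analytic half, which computes the sums over the zeros, and
   an algebraic half, which evaluates the Hankel determinant.

   Analysis. Put [y = x ^ 2]. The truncations of the series factor as
   [\prod_i (1 - b_i y)]. Landau's inequality bounds any product
   [\prod_(i in I) (r |b_i|)] by [\sum_k r ^ k |c_k|], so the [b_i], sorted by
   decreasing modulus, satisfy [|b_i| <= M / (i + 1) ^ 2] uniformly in the
   truncation. Hence they converge along an ultrafilter, and since the tails are
   uniformly small, the limits [beta_i] have the power sums prescribed by Newton's
   identities. The Taylor coefficients of the truncations at [z] converge to those
   of the entire function; reading them off the factorization, the head of which
   converges and the tail of which is bounded and bounded away from 0 at [z], shows
   that the order of the zero [z] is the number of [i] with [beta_i z ^ 2 = 1].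
   This replaces Hurwitz's and Hadamard's theorems.

   Algebra. With [a = 1 / nu], Bessel's equation gives
   [sigma (l + 2) = - nu L (t ^ l (t ^ 2 - a ^ 2))], where the moments of the
   functional [L] have generating function [J_nu / J_nu'] up to normalization.
   The [q_n] are orthogonal for [L], their functions of the second kind being
   multiples of [J_(nu + n) / J_nu'], and the determinant is Christoffel's formula
   for the modified functional [L ((t ^ 2 - a ^ 2) .)]. *)
Require Import Defs.
From mathcomp Require Import all_boot all_order all_algebra.
From mathcomp Require Import finmap.
From mathcomp Require Import all_classical all_reals all_analysis.
From mathcomp Require Import fingroup perm complex.
From mathcomp Require Import ring lra zify.
Set Implicit Arguments.
Unset Strict Implicit.
Unset Printing Implicit Defensive.
Import Order.TTheory GRing.Theory Num.Theory.
Import numFieldNormedType.Exports.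
Local Open Scope classical_set_scope.
Local Open Scope ring_scope.
Local Open Scope complex_scope.

(** * Power series of Bessel functions *)

Section SeriesDivision.
Variable F : fieldType.
Implicit Types (a b s : nat -> F).

Definition conv a b (n : nat) : F := \sum_(j < n.+1) a j * b (n - j)%N.

(** Each quotient coefficient depends on all earlier ones, so the recursion carries their list.
    There is no division by [b 0]: the result is the quotient of formal series when [b 0 = 1]. *)
Fixpoint series_quo_rec a b (n : nat) : seq F :=
  if n is m.+1 then
    let s := series_quo_rec a b m in
    rcons s (a m - \sum_(j < m) s`_j * b (m - j)%N)
  else [::].

Definition series_quo a b (n : nat) : F := (series_quo_rec a b n.+1)`_n.

Lemma size_series_quo_rec a b n : size (series_quo_rec a b n) = n.
Proof. by elim: n => //= n IHn; rewrite size_rcons IHn. Qed.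

Lemma nth_series_quo_rec a b m n : (m < n)%N ->
  (series_quo_rec a b n)`_m = series_quo a b m.
Proof.
elim: n => // n IHn; rewrite ltnS leq_eqVlt => /predU1P[-> //|lmn].
by rewrite /= nth_rcons size_series_quo_rec lmn IHn.
Qed.

Lemma conv_series_quo a b n : b 0%N = 1 -> conv (series_quo a b) b n = a n.
Proof.
move=> b0; rewrite /conv big_ord_recr /= subnn b0 mulr1 /series_quo /=.
rewrite nth_rcons size_series_quo_rec ltnn eqxx addrC -addrA.
rewrite (eq_bigr (fun j : 'I_n => series_quo a b j * b (n - j)%N)).
  by rewrite addNr addr0.
by move=> j _; rewrite nth_series_quo_rec.
Qed.

(** Convolution with a series of constant term 1 is unitriangular. The version bounded by [N] serves
    for truncations, whose coefficients agree with those of the full series only up to their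
    degree. *)
Lemma conv_inj_upto b s t N : b 0%N = 1 ->
  (forall n, (n < N)%N -> conv s b n = conv t b n) ->
  forall n, (n < N)%N -> s n = t n.
Proof.
move=> b0 eq_st; elim/ltn_ind => n IHn lt_nN.
have := eq_st n lt_nN; rewrite /conv !big_ord_recr /= subnn b0 !mulr1.
rewrite (eq_bigr (fun j : 'I_n => t j * b (n - j)%N)); first exact: addrI.
by move=> j _; rewrite IHn // (ltn_trans (ltn_ord j)).
Qed.

Lemma conv_inj b s t : b 0%N = 1 -> conv s b =1 conv t b -> s =1 t.
Proof. by move=> b0 eq_st n; apply: (@conv_inj_upto b _ _ n.+1 b0). Qed.

Lemma convS a b n : conv a b n.+1 = a 0%N * b n.+1 + conv (fun j => a j.+1) b n.
Proof. by rewrite /conv big_ord_recl subn0. Qed.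

Lemma convB a a' b n : conv (fun j => a j - a' j) b n = conv a b n - conv a' b n.
Proof. by rewrite /conv -sumrB; apply: eq_bigr => j _; rewrite mulrBl. Qed.

Lemma convZ k a b n : conv (fun j => k * a j) b n = k * conv a b n.
Proof. by rewrite /conv mulr_sumr; apply: eq_bigr => j _; rewrite mulrA. Qed.

Lemma series_quo0 a b : b 0%N = 1 -> series_quo a b 0%N = a 0%N.
Proof.
by move=> b0; rewrite -[RHS](conv_series_quo a 0 b0) /conv big_ord1 b0 mulr1.
Qed.

End SeriesDivision.

Section BesselSeries.
Variables (R : realType) (nu : R).
Hypothesis hnu : forall k : nat, nu <> - k%:R.

Lemma nuD_neq0 (k : nat) : nu + k%:R != 0.
Proof. by apply/eqP => /eqP; rewrite addr_eq0 => /eqP/(hnu (k := k)). Qed.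

Lemma nu_neq0 : nu != 0.
Proof. by have := nuD_neq0 0; rewrite addr0. Qed.

Lemma pochhammerS (a : R) k :
  pochhammer a k.+1 = pochhammer a k * (a + k%:R).
Proof. by rewrite /pochhammer big_ord_recr. Qed.

Lemma pochhammerSl (a : R) k :
  pochhammer a k.+1 = a * pochhammer (a + 1) k.
Proof.
rewrite /pochhammer big_ord_recl addr0; congr (_ * _); apply: eq_bigr => i _.
by rewrite lift0 -natr1 addrAC addrA.
Qed.

Lemma pochhammer_neq0 n k : pochhammer (nu + n%:R) k != 0.
Proof.
apply/prodf_neq0 => i _; rewrite -addrA -natrD; exact: nuD_neq0.
Qed.

Lemma pochhammer_half_neq0 k : pochhammer (nu / 2) k != 0.
Proof.
apply/prodf_neq0 => i _.
have -> : nu / 2 + i%:R = (nu + (2 * i)%:R) / 2 by rewrite natrM; field.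
by rewrite mulf_neq0 ?nuD_neq0 // invr_neq0 // pnatr_eq0.
Qed.

(* [J_(nu + n) x = (x / 2) ^ (nu + n) / Gamma (nu + n + 1) *
   \sum_k bessel_coef n k * x ^ (2 * k)] *)
Definition bessel_coef (n k : nat) : R :=
  (- 1) ^+ k / (k`!%:R * 4 ^+ k * pochhammer (nu + n.+1%:R) k).

Lemma bessel_coef0 n : bessel_coef n 0 = 1.
Proof. by rewrite /bessel_coef /pochhammer big_ord0 fact0 expr0 !mul1r invr1. Qed.

Lemma bessel_coefS n k : bessel_coef n k.+1 =
  - bessel_coef n k / (4 * k.+1%:R * (nu + n.+1%:R + k%:R)).
Proof.
rewrite /bessel_coef factS natrM !exprS pochhammerS.
have := pochhammer_neq0 n.+1 k; have := nuD_neq0 (n.+1 + k).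
rewrite natrD addrA => h1 h2.
have h3 : k`!%:R != 0 :> R by rewrite pnatr_eq0 -lt0n fact_gt0.
have h4 : (4 : R) ^+ k != 0 by rewrite expf_neq0 // pnatr_eq0.
have h5 : k.+1%:R != 0 :> R by rewrite pnatr_eq0.
move: (pochhammer _ _) h2 (4 ^+ k) h4 ((-1) ^+ k) => p h2 q h4 e.
move: (nu + _ + _) h1 k.+1%:R h5 => x h1 y h5.
by field; rewrite h1 h2 h3 h4 h5.
Qed.

(** This is termwise differentiation of [J_nu], through [(nu/2 + 1)_k / (nu/2)_k = (nu + 2 k) /
    nu]. *)
Lemma dbessel_coefE k :
  dbessel_coef nu k = bessel_coef 0 k * (nu + (2 * k)%:R) / nu.
Proof.
have H : pochhammer (nu / 2 + 1) k * nu =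
         pochhammer (nu / 2) k * (nu + (2 * k)%:R).
  have := pochhammerS (nu / 2) k; rewrite pochhammerSl natrM => E.
  have E2 : 2 * (nu / 2 * pochhammer (nu / 2 + 1) k) =
            2 * (pochhammer (nu / 2) k * (nu / 2 + k%:R)) by rewrite E.
  transitivity (2 * (nu / 2 * pochhammer (nu / 2 + 1) k)); first by field.
  by rewrite E2; field.
rewrite /dbessel_coef /bessel_coef.
apply: (mulIf nu_neq0); rewrite [RHS]mulfVK ?nu_neq0 //.
rewrite mulrAC -[_ * pochhammer (nu / 2 + 1) k * nu]mulrA H.
have := pochhammer_neq0 1 k; have := pochhammer_half_neq0 k.
have h3 : k`!%:R != 0 :> R by rewrite pnatr_eq0 -lt0n fact_gt0.
have h4 : (4 : R) ^+ k != 0 by rewrite expf_neq0 // pnatr_eq0.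
by move=> h1 h2; field; rewrite h1 h2 h3 h4.
Qed.

Lemma dbessel_coef0 : dbessel_coef nu 0 = 1.
Proof. by rewrite dbessel_coefE bessel_coef0 mul1r addr0 divff ?nu_neq0. Qed.

(** The coefficient form of [J_(nu+n) + J_(nu+n+2) = (2 (nu+n+1) / x) J_(nu+n+1)]. *)
Lemma bessel_coef_contiguous n k :
  bessel_coef n.+1 k.+1 - bessel_coef n k.+1 =
  q_beta nu n.+2 * bessel_coef n.+2 k.
Proof.
have E : bessel_coef n k.+1 =
    bessel_coef n.+1 k.+1 * (nu + n.+2%:R + k%:R) / (nu + n.+1%:R).
  rewrite /bessel_coef [in LHS]pochhammerSl pochhammerS.
  rewrite -[nu + n.+1%:R + 1]addrA natr1.
  have := pochhammer_neq0 n.+2 k; have := nuD_neq0 (n.+2 + k); rewrite natrD addrA.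
  have := nuD_neq0 n.+1.
  have h3 : k.+1`!%:R != 0 :> R by rewrite pnatr_eq0 -lt0n fact_gt0.
  have h4 : (4 : R) ^+ k.+1 != 0 by rewrite expf_neq0 // pnatr_eq0.
  move: (nu + n.+1%:R) (nu + n.+2%:R) (pochhammer _ _) => x y p h1 h2 h5.
  move: (_ ^+ _) (_ ^+ _) (_`!%:R) h3 h4 => u v w h3 h4.
  field. by rewrite h1 h2 h3 h4 h5.
have E2 : bessel_coef n.+1 k.+1 =
    - bessel_coef n.+2 k / (4 * k.+1%:R * (nu + n.+2%:R)).
  rewrite /bessel_coef [in LHS]pochhammerSl factS natrM !exprS.
  rewrite -[nu + n.+2%:R + 1]addrA natr1.
  have := pochhammer_neq0 n.+3 k; have := nuD_neq0 n.+2.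
  have h3 : k`!%:R != 0 :> R by rewrite pnatr_eq0 -lt0n fact_gt0.
  have h4 : (4 : R) ^+ k != 0 by rewrite expf_neq0 // pnatr_eq0.
  have h5 : k.+1%:R != 0 :> R by rewrite pnatr_eq0.
  move: (nu + n.+2%:R) (pochhammer _ _) k.+1%:R h5 => x p kk h5 h1 h2.
  move: (_ ^+ _) (_ ^+ _) (_`!%:R) h3 h4 => u v w h3 h4.
  field. by rewrite h1 h2 h3 h4 h5.
rewrite E E2 /q_beta.
have := nuD_neq0 n.+2; have := nuD_neq0 n.+1.
have -> : nu + n.+2%:R = nu + n.+1%:R + 1 by rewrite -addrA natr1.
rewrite addrK.
have -> : nu + n.+1%:R + 1 + k%:R = nu + n.+1%:R + k.+1%:R by rewrite -natr1; ring.
have : k.+1%:R != 0 :> R by rewrite pnatr_eq0.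
move: (nu + n.+1%:R) (bessel_coef _ _) k.+1%:R => x y z hz h1 h2.
by field; rewrite h1 h2 hz.
Qed.

(** The coefficient form of [J_nu' = (nu / x) J_nu - J_(nu+1)]. *)
Lemma bessel_dbessel_coef k :
  bessel_coef 0 k.+1 - dbessel_coef nu k.+1 = 2 * q_beta nu 1 * bessel_coef 1 k.
Proof.
have E2 : bessel_coef 0 k.+1 =
    - bessel_coef 1 k / (4 * k.+1%:R * (nu + 1)).
  rewrite /bessel_coef [in LHS]pochhammerSl factS natrM !exprS.
  rewrite -[nu + 1%:R + 1]addrA natr1.
  have := pochhammer_neq0 2 k; have := nuD_neq0 1.
  have h3 : k`!%:R != 0 :> R by rewrite pnatr_eq0 -lt0n fact_gt0.
  have h4 : (4 : R) ^+ k != 0 by rewrite expf_neq0 // pnatr_eq0.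
  have h5 : k.+1%:R != 0 :> R by rewrite pnatr_eq0.
  move: (nu + 1) (pochhammer _ _) k.+1%:R h5 => x p kk h5 h1 h2.
  move: (_ ^+ _) (_ ^+ _) (_`!%:R) h3 h4 => u v w h3 h4.
  field. by rewrite h1 h2 h3 h4 h5.
rewrite dbessel_coefE E2 /q_beta addrK natrM.
have := nuD_neq0 1; have := nu_neq0.
have : k.+1%:R != 0 :> R by rewrite pnatr_eq0.
move: (bessel_coef _ _) k.+1%:R => y z hz h1 h2.
by field; rewrite h1 h2 hz.
Qed.

(* The coefficients of [J_(nu + n) / J_nu'] in [x ^ 2], up to a factor [C x ^ (n + 1)] *)
Definition bessel_quo (n : nat) : nat -> R :=
  series_quo (bessel_coef n) (dbessel_coef nu).

(* [power_sum k] is the sum of the [- 2 (k + 1)]-th powers of the zeros, one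
   from each pair of opposite zeros. *)
Definition power_sum : nat -> R :=
  series_quo (fun k => - (k.+1%:R * dbessel_coef nu k.+1)) (dbessel_coef nu).

Lemma bessel_quo0 n : bessel_quo n 0 = 1.
Proof. by rewrite /bessel_quo series_quo0 ?dbessel_coef0 ?bessel_coef0. Qed.

Lemma bessel_quo_contiguous n k :
  bessel_quo n.+1 k.+1 - bessel_quo n k.+1 =
  q_beta nu n.+2 * bessel_quo n.+2 k.
Proof.
move: k.
apply: (conv_inj (b := dbessel_coef nu)); first exact: dbessel_coef0.
move=> k; rewrite convZ conv_series_quo ?dbessel_coef0 //.
rewrite -bessel_coef_contiguous convB.
(* Both quotients have constant term 1, so the terms split off by the index shift cancel. *)
have := convS (bessel_quo n.+1) (dbessel_coef nu) k.
have := convS (bessel_quo n) (dbessel_coef nu) k.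
rewrite !bessel_quo0 !conv_series_quo ?dbessel_coef0 // => -> ->.
by ring.
Qed.

Lemma bessel_quo1 k : bessel_quo 0 k.+1 = 2 * q_beta nu 1 * bessel_quo 1 k.
Proof.
move: k.
apply: (conv_inj (b := dbessel_coef nu)); first exact: dbessel_coef0.
move=> k; rewrite convZ conv_series_quo ?dbessel_coef0 //.
rewrite -bessel_dbessel_coef.
have := convS (bessel_quo 0) (dbessel_coef nu) k.
rewrite bessel_quo0 conv_series_quo ?dbessel_coef0 // => ->.
by rewrite mul1r addrAC subrr add0r.
Qed.

(** The power sums generate the logarithmic derivative of the series of [J_nu']. Bessel's equation
    eliminates [J_nu''] from it and leaves only the quotient [J_nu / J_nu']. *)
Lemma power_sum_bessel_quo k :
  2 * power_sum k = bessel_quo 0 k / nu - nu * bessel_quo 0 k.+1.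
Proof.
move: k.
apply: (conv_inj (b := dbessel_coef nu)); first exact: dbessel_coef0.
move=> k; rewrite convZ conv_series_quo ?dbessel_coef0 //.
rewrite convB convZ.
under eq_fun do rewrite mulrC; rewrite convZ conv_series_quo ?dbessel_coef0 //.
have := convS (bessel_quo 0) (dbessel_coef nu) k.
rewrite bessel_quo0 conv_series_quo ?dbessel_coef0 // => /eqP.
rewrite mul1r addrC -subr_eq => /eqP <-.
rewrite !dbessel_coefE bessel_coefS natrM -addrA nat1r.
have := nuD_neq0 k.+1; have := nu_neq0.
have : k.+1%:R != 0 :> R by rewrite pnatr_eq0.
move: (bessel_coef _ _) k.+1%:R => y z hz h1 h2.
by field; rewrite h1 h2 hz.
Qed.

End BesselSeries.

(** * Hankel determinants and the Christoffel transformation *)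

Section MomentFunctional.
Variables (F : fieldType) (g : nat -> F).
Implicit Types p q : {poly F}.

Definition moment p : F := \sum_(i < size p) p`_i * g i.

Lemma moment_widen n p : (size p <= n)%N -> moment p = \sum_(i < n) p`_i * g i.
Proof.
move=> le_pn; rewrite /moment (big_ord_widen n (fun i => p`_i * g i)) // big_mkcond.
by apply: eq_bigr => i _; case: ltnP => // ?; rewrite nth_default ?mul0r.
Qed.

Lemma momentD p q : moment (p + q) = moment p + moment q.
Proof.
have [le1 le2] : (size p <= maxn (size p) (size q))%N /\
  (size q <= maxn (size p) (size q))%N by rewrite leq_maxl leq_maxr.
rewrite (moment_widen (size_polyD p q)) (moment_widen le1) (moment_widen le2).
by rewrite -big_split; apply: eq_bigr => i _; rewrite coefD mulrDl.
Qed.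

Lemma momentZ c p : moment (c *: p) = c * moment p.
Proof.
rewrite (moment_widen (size_scale_leq c p)) mulr_sumr.
by apply: eq_bigr => i _; rewrite coefZ mulrA.
Qed.

Lemma momentB p q : moment (p - q) = moment p - moment q.
Proof. by rewrite momentD -scaleN1r momentZ mulN1r. Qed.

Lemma moment0 : moment 0 = 0.
Proof. by rewrite -(scale0r 0) momentZ mul0r. Qed.

Lemma moment_sum (I : Type) (r : seq I) (P : pred I) (f : I -> {poly F}) :
  moment (\sum_(i <- r | P i) f i) = \sum_(i <- r | P i) moment (f i).
Proof. by apply: (big_morph moment momentD moment0). Qed.

Lemma momentXn n : moment 'X^n = g n.
Proof.
rewrite (moment_widen (n := n.+1)) ?size_polyXn // big_ord_recr /= coefXn eqxx mul1r.
rewrite big1 ?add0r // => i _; rewrite coefXn eqn_leq [(n <= i)%N]leqNgt ltn_ord.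
by rewrite andbF mul0r.
Qed.

Lemma moment_mull n p q : (size p <= n)%N ->
  moment (p * q) = \sum_(i < n) p`_i * moment ('X^i * q).
Proof.
move=> le_pn; rewrite -[p in LHS](coefK p) poly_def mulr_suml moment_sum.
rewrite (big_ord_widen n (fun i => moment (p`_i *: 'X^i * q))) // big_mkcond.
apply: eq_bigr => i _; case: ltnP => [_|?]; first by rewrite -scalerAl momentZ.
by rewrite nth_default ?mul0r.
Qed.

Lemma coef_big (P : nat -> {poly F}) i :
  (forall j, size (P j) = j.+1) -> forall j, (i > j)%N -> (P j)`_i = 0.
Proof. by move=> szP j lt_ji; rewrite nth_default ?szP. Qed.

(* A change of basis from the monomials to monic polynomials is unitriangular. *)
Lemma det_moment_monic n (u : nat -> {poly F}) (P : nat -> {poly F}) :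
  (forall j, size (P j) = j.+1) -> (forall j, P j \is monic) ->
  \det (\matrix_(i < n, j < n) moment (u i * P j)) =
  \det (\matrix_(i < n, j < n) moment (u i * 'X^j)).
Proof.
move=> szP monP.
have -> : \matrix_(i < n, j < n) moment (u i * P j) =
  \matrix_(i < n, j < n) moment (u i * 'X^j) *m
  (\matrix_(j < n, k < n) (P j)`_k)^T.
  apply/matrixP => i j; rewrite !mxE mulrC (@moment_mull n) ?szP //.
  by apply: eq_bigr => k _; rewrite !mxE mulrC; congr (moment _ * _); rewrite mulrC.
rewrite det_mulmx det_tr [X in _ * X]det_trig.
  rewrite big1 ?mulr1 // => i _; rewrite mxE.
  by have := monP i; rewrite monicE lead_coefE szP => /eqP.
by apply/is_trig_mxP => i j lt_ij; rewrite mxE coef_big.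
Qed.

End MomentFunctional.

(** * Christoffel's formula for a symmetric functional modified by [x ^ 2 - a ^ 2] *)

Section Christoffel.
Variables (F : fieldType) (g : nat -> F) (P : nat -> {poly F}) (a : F).
Hypothesis size_P : forall j, size (P j) = j.+1.
Hypothesis monic_P : forall j, P j \is monic.
Hypothesis P_parity : forall j k, odd k != odd j -> (P j)`_k = 0.
Hypothesis P_orthogonal : forall j (p : {poly F}), (size p <= j)%N -> moment g (p * P j) = 0.
Hypothesis P_norm_neq0 : forall j, moment g (P j * P j) != 0.
Hypothesis a_neq0 : a != 0.

Let w : {poly F} := 'X^2 - (a ^+ 2)%:P.

(** For [i < n + 2] these are [n] multiples of [w] completed by [P n] and [P n.+1], all of size at
    most [n + 2]. *)
Let basis n i : {poly F} := if (i < n)%N then 'X^i * w else P i.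

(* The evaluations at [a] and [- a] enter through the even and odd parts, which
   avoids dividing by 2. *)
Let even_eval k : F := if odd k then 0 else a ^+ k.
Let odd_eval k : F := if odd k then a ^+ k.-1 else 0.

Lemma moment_monicXn j : moment g ('X^j * P j) = moment g (P j * P j).
Proof.
rewrite (@moment_mull _ _ j.+1 (P j)) ?size_P // big_ord_recr /= big1 ?add0r => [|i _].
  by have := monic_P j; rewrite monicE lead_coefE size_P => /eqP ->; rewrite mul1r.
by rewrite P_orthogonal ?mulr0 // size_polyXn.
Qed.

Lemma coef_shift_w i k :
  ('X^i * w)`_k = (if k == i.+2 then 1 else 0) - (if k == i then a ^+ 2 else 0).
Proof.
rewrite mulrC mulrBl -exprD add2n coefB coefXn mul_polyC coefZ coefXn.
by congr (_ - _); case: eqP; rewrite ?mulr1 ?mulr0.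
Qed.

Lemma size_shift_w i : size ('X^i * w) = i.+3.
Proof.
rewrite mulrC size_Mmonic ?monicXn //.
  by rewrite size_polyXn size_XnsubC // addnS.
by apply/eqP => /(congr1 (size \o val)) /=; rewrite size_XnsubC // size_poly0.
Qed.

Lemma size_basis n i : (i < n + 2)%N -> (size (basis n i) <= n + 2)%N.
Proof.
rewrite /basis; case: ifP => [lt_in _|_]; last by rewrite size_P.
by rewrite size_shift_w addn2 !ltnS.
Qed.

Lemma sum_coef_shift_w i (h : nat -> F) n : (i.+2 < n)%N ->
  \sum_(k < n) ('X^i * w)`_k * h k = h i.+2 - a ^+ 2 * h i.
Proof.
move=> lt_in.
have lt_in' : (i < n)%N by apply: ltn_trans lt_in; apply: ltnW.
under eq_bigr do rewrite coef_shift_w mulrBl.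
rewrite sumrB (bigD1 (Ordinal lt_in)) //= eqxx mul1r big1 ?addr0; last first.
  by move=> k; rewrite -val_eqE /= => /negPf ->; rewrite mul0r.
rewrite (bigD1 (Ordinal lt_in')) //= eqxx big1 ?addr0 //.
by move=> k; rewrite -val_eqE /= => /negPf ->; rewrite mul0r.
Qed.

(** The coefficient matrix is multiplied by a matrix [C] of determinant 1. Its first [n] columns
    select the coefficients of index at least 2; its last two are the even and odd evaluations,
    which vanish on multiples of [w]. The product is block triangular, and its last block contains
    the values of [P n] and [P n.+1] at [a]. *)
Lemma det_coef_basis n :
  \det (\matrix_(i < n + 2, k < n + 2) (basis n i)`_k) =
  (-1) ^+ n * (P n).[a] * (P n.+1).[a] / a.
Proof.
set X := \matrix_(i, k) _.
(* [C0] is unitriangular with the two evaluations in front. Rotating the columns twice moves them to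
   the end, and the square of a permutation is even, so the determinant stays 1. *)
pose C0 : 'M[F]_(n + 2) := \matrix_(k, j)
  if j == 0%N :> nat then even_eval k else
  if j == 1%N :> nat then odd_eval k else (k == j :> nat)%:R.
pose s : {perm 'I_(n + 2)} := perm (@ordS_inj (n + 2)).
pose C := col_perm (s * s)%g C0.
have CE (k j : 'I_(n + 2)) : C k j =
    if (j < n)%N then (k == j.+2 :> nat)%:R else
    if j == n :> nat then even_eval k else odd_eval k.
  rewrite /C mxE permM !permE mxE /=.
  have [lt_jn|le_nj] := ltnP j n.
    have lt1 : (j.+1 < n + 2)%N by lia.
    by rewrite (modn_small lt1) modn_small //; lia.
  have [ejn|nejn] := eqVneq (val j) n.
    have lt1 : (n.+1 < n + 2)%N by rewrite addn2.
    by rewrite ejn (modn_small lt1) -[X in (X %% _)%N]addn2 modnn eqxx.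
  have ejn : val j = n.+1.
    apply/eqP; rewrite eqn_leq -ltnS -[n.+2]addn2 ltn_ord /=.
    by rewrite ltn_neqAle eq_sym nejn.
  have -> : (j.+1 %% (n + 2) = 0)%N by rewrite ejn -[X in (X %% _)%N]addn2 modnn.
  by rewrite modn_small ?addn2 // ejn gtn_eqF.
have detC : \det C = 1.
  rewrite /C col_permE det_mulmx det_perm odd_permV odd_permM addbb mulr1.
  rewrite det_trig ?big1 // => [i _|].
    rewrite mxE; case: eqP => [i0|_]; first by rewrite i0 /even_eval expr0.
    by case: eqP => [i1|_]; rewrite ?eqxx // i1 /odd_eval expr0.
  apply/is_trig_mxP => i j lt_ij; rewrite mxE.
  case: eqP => [j0|_]; first by rewrite j0 in lt_ij.
  case: eqP => [j1|_].
    by move: lt_ij; rewrite j1 ltnS leqn0 => /eqP ->.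
  by rewrite ltn_eqF.
clearbody C.
have even_E i : (i <= n.+1)%N -> \sum_(k < n + 2) (P i)`_k * even_eval k =
    if odd i then 0 else (P i).[a].
  move=> le_in; case: ifP => oi.
    rewrite big1 // => k _; rewrite /even_eval; case: ifP => ok; rewrite ?mulr0 //.
    by rewrite P_parity ?mul0r // oi ok.
  rewrite (@horner_coef_wide _ (n + 2)) ?size_P ?addn2 //.
  apply: eq_bigr => k _; rewrite /even_eval; case: ifP => ok //.
  by rewrite P_parity ?mul0r // oi ok.
have odd_E i : (i <= n.+1)%N -> \sum_(k < n + 2) (P i)`_k * odd_eval k =
    if odd i then (P i).[a] / a else 0.
  move=> le_in; case: ifP => oi; last first.
    rewrite big1 // => k _; rewrite /odd_eval; case: ifP => ok; rewrite ?mulr0 //.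
    by rewrite P_parity ?mul0r // oi ok.
  rewrite (@horner_coef_wide _ (n + 2)) ?size_P ?addn2 // mulr_suml.
  apply: eq_bigr => k _; rewrite /odd_eval; case: ifP => ok; last first.
    by rewrite P_parity ?mul0r // oi ok.
  by case: (val k) ok => // m _; rewrite exprSr mulrA mulfK.
transitivity (\det (X *m C)); first by rewrite det_mulmx detC mulr1.
rewrite -[X *m C]submxK.
(* Both evaluations send the two terms of ['X^(i.+2) - a ^+ 2 *: 'X^i] to the same value. *)
have -> : ursubmx (X *m C) = 0.
  apply/matrixP => i j; rewrite !mxE.
  transitivity (\sum_(k < n + 2) ('X^i * w)`_k *
      (if j == 0%N :> nat then even_eval k else odd_eval k)).
    apply: eq_bigr => k _; rewrite !mxE CE /basis /= ltn_ord ltnNge leq_addr /=.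
    by rewrite -[X in _ == X]addn0 eqn_add2l.
  rewrite (@sum_coef_shift_w i
    (fun k => if j == 0%N :> nat then even_eval k else odd_eval k)) ?addn2 ?ltnS //.
  case: ifP => _; rewrite /even_eval /odd_eval /= negbK;
    case: (boolP (odd i)) => oi; rewrite ?mulr0 ?subrr // -?exprD ?add2n ?subrr //.
  by case: (val i) oi => // m _; rewrite subrr.
rewrite det_lblock [X in X * _]det_trig; last first.
  apply/is_trig_mxP => i j lt_ij; rewrite !mxE big1 // => k _.
  rewrite !mxE CE /basis /= !ltn_ord coef_shift_w.
  case: (k =P j.+2 :> nat) => [->|_]; rewrite ?mulr0 //.
  by rewrite gtn_eqF ?ltnS // gtn_eqF ?subr0 ?mul0r // ltnS ltnW // ltnW.
rewrite big1 ?mul1r => [|i _]; last first.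
  rewrite !mxE.
  transitivity (\sum_(k < n + 2) ('X^i * w)`_k * (k == i.+2 :> nat)%:R).
    by apply: eq_bigr => k _; rewrite !mxE CE /basis /= !ltn_ord.
  rewrite (@sum_coef_shift_w i (fun k => (k == i.+2 :> nat)%:R)) ?addn2 ?ltnS //.
  by rewrite eqxx ltn_eqF ?mulr0 ?subr0.
have -> : drsubmx (X *m C) = \matrix_(i, j)
    if j == 0 then if odd (n + i) then 0 else (P (n + i)%N).[a]
    else if odd (n + i) then (P (n + i)%N).[a] / a else 0.
  apply/matrixP => i j; rewrite [RHS]mxE.
  have le_in : (n + i <= n.+1)%N by have := ltn_ord i; lia.
  rewrite -even_E // -odd_E // !mxE; case: eqP => [j0|/eqP nj0].
    apply: eq_bigr => k _; rewrite !mxE CE /basis /= !ltnNge !leq_addr /=.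
    by rewrite j0 addn0 eqxx.
  apply: eq_bigr => k _; rewrite !mxE CE /basis /= !ltnNge !leq_addr /=.
  by rewrite -[X in _ == X]addn0 eqn_add2l -[_ == 0%N]/(j == 0) (negPf nj0).
(* By parity this 2 by 2 block is diagonal for even [n] and antidiagonal for odd [n], whence the
   sign. *)
rewrite (expand_det_row _ ord0) big_ord_recl big_ord1 /cofactor !det_mx11.
rewrite !mxE /= addn0 addn1 addn0 expr0 expr1 -signr_odd /=; case: (odd n) => /=.
  by rewrite expr1 mul0r add0r; field.
by rewrite expr0 mul0r addr0; field.
Qed.

(** The determinant of the moments of [basis n i * P j] is computed twice. Expanding [basis n i] in
    monomials gives the coefficient determinant times all the norms. Reading the matrix in blocks,
    orthogonality kills the lower left block and leaves the wanted determinant times the last two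
    norms, which cancel. *)
Lemma det_christoffel n :
  \det (\matrix_(i < n, j < n) moment g ('X^(i + j) * w)) =
  (-1) ^+ n * (P n).[a] * (P n.+1).[a] / a *
  \prod_(j < n) moment g (P j * P j).
Proof.
pose h j := moment g (P j * P j).
pose Y : 'M[F]_(n + 2) := \matrix_(i, j) moment g (basis n i * P j).
have YE : \det Y =
    \det (\matrix_(i < n + 2, k < n + 2) (basis n i)`_k) * \prod_(j < n + 2) h j.
  have -> : Y = (\matrix_(i < n + 2, k < n + 2) (basis n i)`_k) *m
      (\matrix_(k < n + 2, j < n + 2) moment g ('X^k * P j)).
    apply/matrixP => i j; rewrite !mxE (moment_mull _ _ (size_basis (ltn_ord i))).
    by apply: eq_bigr => k _; rewrite !mxE.
  rewrite det_mulmx [X in _ * X]det_trig.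
    by congr (_ * _); apply: eq_bigr => j _; rewrite mxE moment_monicXn.
  by apply/is_trig_mxP => k j lt_kj; rewrite mxE P_orthogonal // size_polyXn.
have : \det Y = \det (\matrix_(i < n, j < n) moment g ('X^(i + j) * w)) *
    (h n * h n.+1).
  rewrite -[Y]submxK.
  have -> : dlsubmx Y = 0.
    apply/matrixP => i j; rewrite !mxE /basis /= ltnNge leq_addr /= mulrC.
    by rewrite P_orthogonal // size_P (leq_trans (ltn_ord j)) // leq_addr.
  rewrite det_ublock; congr (_ * _).
    transitivity (\det (\matrix_(i < n, j < n) moment g ('X^i * w * P j))).
      by congr (\det _); apply/matrixP => i j; rewrite !mxE /basis /= ltn_ord.
    rewrite (@det_moment_monic _ g n (fun i => 'X^i * w)) //.
    congr (\det _); apply/matrixP => i j; rewrite !mxE exprD.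
    by rewrite -!mulrA [w * _]mulrC.
  rewrite det_trig.
    rewrite big_ord_recl big_ord1 !mxE /basis /= addn0 addn1 ltnn ltnNge leqnSn.
    by [].
  apply/is_trig_mxP => i j lt_ij; rewrite !mxE /basis /= ltnNge leq_addr /=.
  by rewrite P_orthogonal // size_P ltn_add2l.
rewrite YE det_coef_basis => /esym E.
apply: (mulIf (mulf_neq0 (P_norm_neq0 n) (P_norm_neq0 n.+1))).
rewrite E addn2 !big_ord_recr /=.
by rewrite !mulrA.
Qed.

End Christoffel.

(** * The orthogonal polynomials [q_n] and the Hankel determinant of the power sums *)

Section HankelOfPowerSums.
Variables (R : realType) (nu : R).
Hypothesis hnu : forall k : nat, nu <> - k%:R.

(* The moments of the functional for which the [q_poly nu n] are orthogonal;
   their generating function is [J_nu / J_nu'], up to normalization. *)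
Let bessel_moment k : R := if odd k then 0 else bessel_quo nu 0 k./2.
Let L := moment bessel_moment.

Let kappa n : R := \prod_(i < n) q_beta nu i.+1.

Lemma q_polySS n : q_poly nu n.+2 =
  'X * q_poly nu n.+1 - q_beta nu n.+1 *: q_poly nu n.
Proof. by []. Qed.

Lemma q_beta_neq0 n : q_beta nu n.+1 != 0.
Proof.
rewrite /q_beta mul1r invr_neq0 //.
have -> : nu + n.+1%:R - 1 = nu + n%:R by rewrite -[n.+1%:R]natr1 addrA addrK.
by rewrite !mulf_neq0 ?nuD_neq0 // pnatr_eq0.
Qed.

(* [J_(nu + n) / J_nu'] is the function of the second kind of [q_poly nu n]. *)
Lemma moment_q_poly n :
  (forall j, (j < n)%N -> L ('X^j * q_poly nu n) = 0) /\
  (forall k, L ('X^(n + k) * q_poly nu n) =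
     kappa n * (if odd k then 0 else bessel_quo nu n k./2)).
Proof.
have rec m j : L ('X^j * q_poly nu m.+2) =
    L ('X^(j.+1) * q_poly nu m.+1) - q_beta nu m.+1 * L ('X^j * q_poly nu m).
  rewrite q_polySS mulrBr /L momentB -scalerAr momentZ mulrA -exprSr.
  by [].
(* The recurrence has three terms, so the induction carries two consecutive indices. *)
suff: (forall j, (j < n)%N -> L ('X^j * q_poly nu n) = 0) /\
  (forall k, L ('X^(n + k) * q_poly nu n) =
     kappa n * (if odd k then 0 else bessel_quo nu n k./2)) /\
  (forall j, (j < n.+1)%N -> L ('X^j * q_poly nu n.+1) = 0) /\
  (forall k, L ('X^(n.+1 + k) * q_poly nu n.+1) =
     kappa n.+1 * (if odd k then 0 else bessel_quo nu n.+1 k./2)) by case=> ? [].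
elim: n => [|n [IH1 [IH2 [IH3 IH4]]]].
  have q1 j : L ('X^j * q_poly nu 1) = 2^-1 * bessel_moment j.+1.
    by rewrite /L /= -scalerAr momentZ -exprSr momentXn.
  split=> //; split=> [k|].
    by rewrite add0n mulr1 /L momentXn /kappa big_ord0 mul1r.
  split=> [j|k]; first by case: j => // _; rewrite q1 mulr0.
  rewrite q1 /bessel_moment add1n /= negbK /kappa big_ord1.
  case: ifP => _; first by rewrite !mulr0.
  by rewrite [q_beta _ _]/(q_beta nu 1) (bessel_quo1 hnu) !mulrA mulVf ?mul1r ?pnatr_eq0.
split=> //; split=> //; split=> [j|k].
  (* For [j = n.+1] both terms are moments of odd total degree; for [j = n] they cancel because
     [kappa n.+1 = kappa n * q_beta nu n.+1]; for [j < n] both vanish by induction. *)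
  rewrite rec ltnS leq_eqVlt => /predU1P[->|].
    have := IH4 1%N; rewrite addn1 /= => ->.
    by have := IH2 1%N; rewrite addn1 /= => ->; rewrite !mulr0 subrr.
  rewrite ltnS leq_eqVlt => /predU1P[->|lt_jn].
    have := IH4 0%N; rewrite addn0 /= => ->.
    have := IH2 0%N; rewrite addn0 /= => ->.
    by rewrite !bessel_quo0 // !mulr1 /kappa big_ord_recr /= mulrC subrr.
  by rewrite IH1 // IH3 ?mulr0 ?subrr.
have -> : (n.+2 + k = (n + k.+2))%N by rewrite !addnS.
rewrite rec IH2 -[(n + k.+2).+1]addSn IH4 /= negbK.
case: ifP => _; first by rewrite !mulr0 subrr.
rewrite [kappa n.+2]/kappa big_ord_recr /= -/(kappa n.+1).
rewrite -[RHS]mulrA -bessel_quo_contiguous // mulrBr; congr (_ - _).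
by rewrite mulrA /kappa big_ord_recr /= [_ * q_beta _ _]mulrC.
Qed.

(** Since [q_1 = x / 2], every [q_n] with [n > 0] has leading coefficient 1/2. Making the family
    monic moves this anomaly into the first recurrence coefficient, which is doubled. *)
Definition q_monic n : {poly R} := if n is 0 then 1 else 2 *: q_poly nu n.

Lemma q_monicSS n : q_monic n.+2 = 'X * q_monic n.+1 -
  (q_beta nu n.+1 * (if n is 0 then 2 else 1)) *: q_monic n.
Proof.
rewrite /q_monic q_polySS scalerBr -scalerAr; congr (_ - _).
by case: n => [|n]; rewrite /= !scalerA ?mulr1 1?mulrC // -scalerA.
Qed.

Lemma q_monic_spec n : size (q_monic n) = n.+1 /\ q_monic n \is monic.
Proof.
suff: (size (q_monic n) = n.+1 /\ q_monic n \is monic) /\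
      (size (q_monic n.+1) = n.+2 /\ q_monic n.+1 \is monic) by case.
elim: n => [|n [[szn monn] [szn1 monn1]]]; split=> //.
- by split; [rewrite size_poly1 | exact: monic1].
- by rewrite /= scalerA divff ?pnatr_eq0 // scale1r size_polyX monicX.
have szX : size ('X * q_monic n.+1) = n.+3.
  by rewrite mulrC size_mulX ?szn1 // monic_neq0.
have lt_sz : (size (- ((q_beta nu n.+1 * (if n is 0 then 2 else 1)) *: q_monic n))%R
    < size ('X * q_monic n.+1)%R)%N.
  by rewrite size_polyN szX (leq_ltn_trans (size_scale_leq _ _)) // szn ltnW.
rewrite q_monicSS size_polyDl // szX; split=> //.
by rewrite monicE lead_coefDl // lead_coefM lead_coefX mul1r -monicE.
Qed.

Lemma q_monic_parity n k : odd k != odd n -> (q_monic n)`_k = 0.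
Proof.
move: k; suff: (forall k, odd k != odd n -> (q_monic n)`_k = 0) /\
  (forall k, odd k != odd n.+1 -> (q_monic n.+1)`_k = 0) by case.
elim: n => [|n [IHn IHn1]]; split=> // k.
- by case: k => [|k] //; rewrite coef1.
- by case: k => [|[|k]] //=; rewrite coefZ coefZ coefX ?mulr0.
move=> ok; have ok' : odd k != odd n by rewrite -[odd n]negbK.
rewrite q_monicSS coefB coefXM [X in _ - X]coefZ IHn // mulr0 subr0.
case: k ok {ok'} => // k ok; apply: IHn1.
by move: ok => /=; case: (odd k); case: (odd n).
Qed.

Lemma q_monic_orthogonal n (p : {poly R}) : (size p <= n)%N ->
  L (p * q_monic n) = 0.
Proof.
move=> le_pn; rewrite /L (moment_mull _ _ le_pn) big1 // => i _.
case: n i le_pn => [[]//|n] i _.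
by rewrite -scalerAr momentZ [moment _ _](proj1 (moment_q_poly _)) ?mulr0.
Qed.

Lemma q_monic_norm n :
  L (q_monic n * q_monic n) = (if n is 0 then 1 else 2) * kappa n.
Proof.
rewrite /L -(moment_monicXn (P := q_monic)); first last.
- by move=> *; apply: q_monic_orthogonal.
- by move=> j; have [] := q_monic_spec j.
- by move=> j; have [] := q_monic_spec j.
have := proj2 (moment_q_poly n) 0%N; rewrite addn0 /= bessel_quo0 // mulr1.
case: n => [|n] E; first by rewrite mul1r.
by rewrite -scalerAr momentZ [moment _ _]E.
Qed.

Lemma q_monic_norm_neq0 n : L (q_monic n * q_monic n) != 0.
Proof.
rewrite q_monic_norm mulf_neq0 //; first by case: n; rewrite ?oner_eq0 ?pnatr_eq0.
by apply/prodf_neq0 => i _; apply: q_beta_neq0.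
Qed.

Lemma prod_q_monic_norm n : \prod_(j < n.+1) L (q_monic j * q_monic j) =
  (nu ^+ n * 2 ^+ (n ^ 2) *
   \prod_(1 <= i < n.+1) (nu + i%:R) ^+ (2 * (n - i) + 1))^-1.
Proof.
rewrite (eq_bigr (fun j : 'I_n.+1 => (if val j is 0 then 1 else 2) * kappa j));
  last by move=> j _; exact: q_monic_norm.
elim: n => [|n IHn]; first by rewrite big_ord1 big_geq // /kappa big_ord0 !mul1r invr1.
rewrite big_ord_recr /= IHn.
(* Each interior factor [nu + i] occurs in two consecutive [q_beta], and the two extreme factors
   occur once. *)
have -> : kappa n.+1 = (4 ^+ n.+1 * nu * (nu + n.+1%:R) *
    (\prod_(1 <= i < n.+1) (nu + i%:R)) ^+ 2)^-1.
  elim: (n) => [|m IHm].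
    by rewrite /kappa big_ord1 /q_beta big_geq // expr1 addrK expr1n mulr1 mul1r.
  rewrite /kappa big_ord_recr /= -/(kappa m.+1) IHm [in RHS]big_nat_recr //= exprMn.
  rewrite /q_beta [4 ^+ m.+2]exprS.
  have -> : nu + m.+2%:R - 1 = nu + m.+1%:R by rewrite -[m.+2%:R]natr1 addrA addrK.
  have := nuD_neq0 hnu m.+1; have := nuD_neq0 hnu m.+2; have := nu_neq0 hnu.
  have : \prod_(1 <= i < m.+1) (nu + i%:R) != 0.
    by rewrite prodf_seq_neq0; apply/allP => i _; apply: nuD_neq0.
  have : (4 : R) ^+ m.+1 != 0 by rewrite expf_neq0 ?pnatr_eq0.
  move: (\prod_(_ <= _ < _) _) (_ ^+ _) (nu + _) (nu + _) => x y z t hx hy h1 h2 h3.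
  by field; rewrite hx hy h1 h2 h3.
rewrite [in RHS]big_nat_recr //= subnn muln0 add0n expr1.
have -> : \prod_(1 <= i < n.+1) (nu + i%:R) ^+ (2 * (n.+1 - i) + 1) =
    \prod_(1 <= i < n.+1) (nu + i%:R) ^+ (2 * (n - i) + 1) *
    (\prod_(1 <= i < n.+1) (nu + i%:R)) ^+ 2.
  rewrite -prodrXl -big_split /= big_nat [RHS]big_nat; apply: eq_bigr => i.
  by rewrite ltnS => /andP[_ le_in]; rewrite -exprD subSn //; congr (_ ^+ _); lia.
(* The division by 2 is matched by the factor 2 in the norm of [q_monic n.+1]. *)
have -> : (2 : R) ^+ (n.+1 ^ 2) = 2 ^+ (n ^ 2) * 4 ^+ n.+1 / 2.
  have -> : (4 : R) = 2 ^+ 2 by rewrite -natrX.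
  apply: (mulIf (x := 2)); first by rewrite pnatr_eq0.
  rewrite mulfVK ?pnatr_eq0 // -exprM -exprD -exprSr; congr (_ ^+ _).
  by rewrite !expnS expn0; lia.
rewrite [nu ^+ n.+1]exprSr -[X in _ / X]/(2%:R).
have := nuD_neq0 hnu n.+1; have := nu_neq0 hnu; have := expf_neq0 n (nu_neq0 hnu).
have : \prod_(1 <= i < n.+1) (nu + i%:R) != 0.
  by rewrite prodf_seq_neq0; apply/allP => i _; apply: nuD_neq0.
have : \prod_(1 <= i < n.+1) (nu + i%:R) ^+ (2 * (n - i) + 1) != 0.
  by rewrite prodf_seq_neq0; apply/allP => i _; apply/expf_neq0/nuD_neq0.
have : (4 : R) ^+ n.+1 != 0 by rewrite expf_neq0 ?pnatr_eq0.
have : (2 : R) ^+ (n ^ 2) != 0 by rewrite expf_neq0 ?pnatr_eq0.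
move: (\prod_(_ <= _ < _) _) (\prod_(_ <= _ < _) _) => x y.
move: (2 ^+ _) (4 ^+ _) (nu + _) (nu ^+ _) => b c d e h1 h2 h3 h4 h5 h6 h7.
by field; rewrite h1 h2 h3 h4 h5 h6 h7.
Qed.

(** This reading of [power_sum_bessel_quo] exhibits the sums over the zeros as the moments of [L]
    modified by [x ^ 2 - 1 / nu ^ 2], which is why the [q_n] are evaluated at [1 / nu]. *)
Lemma moment_shift l :
  (if odd l then 0 else 2 * power_sum nu l./2) =
  - nu * L ('X^l * ('X^2 - ((nu^-1) ^+ 2)%:P)).
Proof.
rewrite mulrBr -exprD /L momentB ['X^l * _%:P]mulrC mul_polyC momentZ !momentXn.
rewrite /bessel_moment addn2 /= negbK; case: ifP => _; first by rewrite mulr0 subr0 mulr0.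
by rewrite power_sum_bessel_quo //; field; rewrite nu_neq0.
Qed.

Lemma det_power_sum n :
  \det (\matrix_(i < n.+1, j < n.+1)
    (if odd (i + j) then 0 else 2 * power_sum nu (i + j)./2)) =
  nu ^+ 2 * (q_poly nu n.+1).[1 / nu] * (q_poly nu n.+2).[1 / nu] /
     (2 ^ ((n ^ 2)%:Z - 2) *
      \prod_(1 <= i < n.+1) (nu + i%:R) ^+ (2 * (n - i) + 1)).
Proof.
have -> : \matrix_(i < n.+1, j < n.+1)
    (if odd (i + j) then 0 else 2 * power_sum nu (i + j)./2) =
  (- nu) *: \matrix_(i < n.+1, j < n.+1)
    L ('X^(i + j) * ('X^2 - ((nu^-1) ^+ 2)%:P)).
  by apply/matrixP => i j; rewrite !mxE moment_shift.
have ninu0 : nu^-1 != 0 by rewrite invr_neq0 // nu_neq0.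
rewrite detZ (det_christoffel _ _ q_monic_parity q_monic_orthogonal
  q_monic_norm_neq0 ninu0); try by move=> j; have [] := q_monic_spec j.
have hq m : (q_monic m.+1).[nu^-1] = 2 * (q_poly nu m.+1).[nu^-1].
  by rewrite hornerZ.
rewrite prod_q_monic_norm !hq div1r [(- nu) ^+ _]exprNn.
(* The exponent is an integer, negative for [n <= 1]. The 4 comes from the two factors 2 in
   [q_monic]. *)
have -> : (2 : R) ^ ((n ^ 2)%:Z - 2) = 2 ^+ (n ^ 2) / 4.
  rewrite expfzDr ?pnatr_eq0 //; congr (_ * _).
  by transitivity (((2 : R) ^+ 2)^-1); last by rewrite -natrX.
have := nu_neq0 hnu; have := expf_neq0 n (nu_neq0 hnu).
have : \prod_(1 <= i < n.+1) (nu + i%:R) ^+ (2 * (n - i) + 1) != 0.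
  by rewrite prodf_seq_neq0; apply/allP => i _; apply/expf_neq0/nuD_neq0.
have : (2 : R) ^+ (n ^ 2) != 0 by rewrite expf_neq0 ?pnatr_eq0.
rewrite [nu ^+ n.+1]exprSr.
(* One sign comes from [(- nu) ^+ n.+1] and the other from Christoffel's formula for size [n.+1]. *)
have : (-1) ^+ n.+1 * (-1) ^+ n.+1 = 1 :> R by rewrite -exprMn mulrNN mulr1 expr1n.
move: (\prod_(_ <= _ < _) _) (_.[_]) (_.[_]) => x y z.
move: (2 ^+ _) (nu ^+ n) ((-1) ^+ _) => b c e he h1 h2 h3 h4.
rewrite -[RHS]mul1r -[X in _ = X * _]he.
by field; rewrite h1 h2 h3 h4.
Qed.

End HankelOfPowerSums.

(** * Reciprocal roots of polynomials *)

Section NewtonIdentities.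
Variable F : fieldType.
Implicit Types (s : seq F) (a : nat -> F).

Lemma convSr a (b : nat -> F) n :
  conv a b n.+1 = conv a (fun j => b j.+1) n + a n.+1 * b 0%N.
Proof.
rewrite /conv big_ord_recr /= subnn; congr (_ + _).
by apply: eq_bigr => j _; rewrite subSn // -ltnS.
Qed.

Lemma conv_mul_linear a w (p : {poly F}) n :
  conv a (fun k => ((1 - w *: 'X) * p)`_k) n.+1 =
  conv a (fun k => p`_k) n.+1 - w * conv a (fun k => p`_k) n.
Proof.
have E k : ((1 - w *: 'X) * p)`_k = p`_k - w * (if k is m.+1 then p`_m else 0).
  by rewrite mulrBl mul1r coefB -scalerAl coefZ coefXM; case: k.
rewrite !convSr E mulr0 subr0 addrAC; congr (_ + _).
by rewrite /conv mulr_sumr -sumrB; apply: eq_bigr => j _; rewrite E; ring.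
Qed.

(** The power sums generate [\sum_w w / (1 - w x)], which is minus the logarithmic derivative of the
    product. The induction splits off one factor at a time. *)
Lemma newton_identity s (p : {poly F}) n : p = \prod_(w <- s) (1 - w *: 'X) ->
  conv (fun j => \sum_(w <- s) w ^+ j.+1) (fun k => p`_k) n =
  - (n.+1%:R * p`_n.+1).
Proof.
move=> ->; elim: s n => [|w s IHs] n.
  by rewrite /conv big1 => [|j _]; rewrite !big_nil ?mul0r // coef1 mulr0 oppr0.
rewrite big_cons; set p' := \prod_(_ <- _) _ in IHs *.
pose q := (1 - w *: 'X) * p'.
have E k : q`_k.+1 = p'`_k.+1 - w * p'`_k.
  by rewrite /q mulrBl mul1r coefB -scalerAl coefZ coefXM.
have q0 : q`_0 = p'`_0 by rewrite /q mulrBl mul1r coefB -scalerAl coefZ coefXM /= mulr0 subr0.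
(* The geometric series [w / (1 - w x)] cancels the factor [1 - w x] of [q]. *)
have geom k : conv (fun j => w ^+ j.+1) (fun k => q`_k) k = w * p'`_k.
  case: k => [|k]; first by rewrite /conv big_ord1 q0 expr1.
  rewrite conv_mul_linear convS expr1 -addrA -convZ.
  rewrite [X in _ + (X - _)](_ : _ = conv (fun j => w * w ^+ j.+1) (fun k => p'`_k) k).
    by rewrite subrr addr0.
  by apply: eq_bigr => j _; rewrite exprS.
transitivity (conv (fun j => w ^+ j.+1) (fun k => q`_k) n +
    conv (fun j => \sum_(w <- s) w ^+ j.+1) (fun k => q`_k) n).
  by rewrite /conv -big_split; apply: eq_bigr => j _; rewrite big_cons mulrDl.
rewrite geom -[_ * p']/q E; case: n => [|n].
  by move: (IHs 0%N); rewrite /conv !big_ord1 /= q0 => ->; ring.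
by rewrite conv_mul_linear !IHs -[n.+2%:R]natr1; ring.
Qed.

End NewtonIdentities.

(** * Landau's inequality for products of reciprocal roots *)

Section Landau.
Variable C : numClosedFieldType.
Implicit Types (s : seq C) (p q : {poly C}).

Definition l2norm2 p : C := \sum_(i < size p) `|p`_i| ^+ 2.

Lemma l2norm2_widen n p : (size p <= n)%N -> l2norm2 p = \sum_(i < n) `|p`_i| ^+ 2.
Proof.
move=> le_pn; rewrite /l2norm2 (big_ord_widen n (fun i => `|p`_i| ^+ 2)) // big_mkcond.
by apply: eq_bigr => i _; case: ltnP => // ?; rewrite nth_default ?normr0 ?expr0n.
Qed.

(* On the unit circle [1 - w z] and [w^* - z] have the same modulus. *)
Lemma l2norm2_reflect w q :
  l2norm2 ((1 - w *: 'X) * q) = l2norm2 ((w^* %:P - 'X) * q).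
Proof.
pose n := (size q).+1.
have E1 k : ((1 - w *: 'X) * q)`_k = q`_k - w * (if k is m.+1 then q`_m else 0).
  by rewrite mulrBl mul1r coefB -scalerAl coefZ coefXM; case: k.
have E2 k : ((w^* %:P - 'X) * q)`_k = w^* * q`_k - (if k is m.+1 then q`_m else 0).
  by rewrite mulrBl coefB mul_polyC coefZ coefXM; case: k.
have sz1 : (size ((1 - w *: 'X) * q)%R <= n)%N.
  by apply/leq_sizeP => -[|k] // lt_k; rewrite E1 !nth_default ?mulr0 ?subrr // ltnW.
have sz2 : (size ((w^* %:P - 'X) * q)%R <= n)%N.
  by apply/leq_sizeP => -[|k] // lt_k; rewrite E2 !nth_default ?mulr0 ?subrr // ltnW.
rewrite (l2norm2_widen sz1) (l2norm2_widen sz2).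
apply/eqP; rewrite -subr_eq0 -sumrB.
rewrite (eq_bigr (fun i : 'I_n => (1 - `|w| ^+ 2) *
   (`|q`_i| ^+ 2 - `|if val i is m.+1 then q`_m else 0| ^+ 2))); last first.
  move=> i _; rewrite E1 E2; move: (q`_i) (if _ is _.+1 then _ else _) => a b.
  by rewrite !normCK !rmorphB !rmorphM /= conjCK; ring.
rewrite -mulr_sumr sumrB big_ord_recr /= [q`_(size q)]nth_default // normr0.
have -> : \sum_(i < n) `|if val i is m.+1 then q`_m else 0| ^+ 2 =
    \sum_(i < size q) `|q`_i| ^+ 2.
  by rewrite big_ord_recl /= normr0 expr0n add0r.
by rewrite expr0n addr0 subrr mulr0.
Qed.

(** Reflecting the factors of [s1] preserves the norm and turns the constant coefficient into the
    product of the conjugates of [s1]. That coefficient is a single term of the sum of squares. *)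
Lemma landau_inequality s1 s2 :
  \prod_(w <- s1) `|w| ^+ 2 <= l2norm2 (\prod_(w <- s1 ++ s2) (1 - w *: 'X)).
Proof.
have -> : l2norm2 (\prod_(w <- s1 ++ s2) (1 - w *: 'X)) =
    l2norm2 (\prod_(w <- s1) (w^* %:P - 'X) * \prod_(w <- s2) (1 - w *: 'X)).
  rewrite big_cat /=; move: (\prod_(_ <- s2) _) => q.
  elim: s1 q => [|w s IHs] q; first by rewrite !big_nil.
  rewrite !big_cons -mulrA l2norm2_reflect.
  by rewrite mulrCA IHs mulrCA mulrA.
set p := _ * _.
have p0 : `|p`_0| ^+ 2 = \prod_(w <- s1) `|w| ^+ 2.
  rewrite -horner_coef0 /p hornerM !horner_prod normrM exprMn !normr_prod -!prodrXl.
  rewrite [X in _ * X]big1 ?mulr1 => [|w _]; last by rewrite !hornerE ?mulr0 ?subr0 normr1 expr1n.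
  by apply: eq_bigr => w _; rewrite !hornerE subr0 norm_conjC.
rewrite -p0; case: (posnP (size p)) => [sz0|].
  by rewrite /l2norm2 nth_default ?sz0 // big_ord0 normr0 expr0n.
rewrite /l2norm2; case: (size p) => // n _.
by rewrite big_ord_recl /= lerDl sumr_ge0 // => i _; rewrite exprn_ge0.
Qed.

Lemma coef_prod_scale r s k :
  (\prod_(w <- s) (1 - (r * w) *: 'X))`_k =
  r ^+ k * (\prod_(w <- s) (1 - w *: 'X))`_k.
Proof.
elim: s k => [|w s IHs] k.
  by rewrite !big_nil coef1; case: k => [|k]; rewrite ?mulr0 // expr0 mul1r.
rewrite !big_cons !mulrBl !mul1r !coefB -!scalerAl !coefZ !coefXM IHs.
by case: k => [|k] /=; rewrite ?mulr0 ?subr0 // IHs exprS; ring.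
Qed.

Lemma factor_at_one p : p`_0 = 1 ->
  exists2 s, p = \prod_(w <- s) (1 - w *: 'X) & (size s <= (size p).-1)%N.
Proof.
move=> p0; have [r Er] := closed_field_poly_normal p.
have szr : size r = (size p).-1.
  rewrite [in RHS]Er size_scale ?size_prod_XsubC //.
  by rewrite lead_coef_eq0; apply: contra_eq_neq p0 => ->; rewrite coef0 eq_sym oner_eq0.
exists (map (fun z => z^-1) r); last by rewrite size_map szr.
have rn0 z : z \in r -> z != 0.
  move=> zr; apply: contra_eq_neq p0 => z0.
  rewrite -horner_coef0 Er hornerZ horner_prod (big_rem _ zr) /=.
  by rewrite hornerXsubC z0 subrr mul0r mulr0 eq_sym oner_eq0.
have -> : p = (lead_coef p * \prod_(z <- r) (- z)) *:
    \prod_(w <- map (fun z => z^-1) r) (1 - w *: 'X).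
  rewrite {1}Er -scalerA; congr (_ *: _).
  rewrite big_map big_seq [X in _ = X *: _]big_seq [X in _ = _ *: X]big_seq.
  rewrite -scaler_prod; apply: eq_bigr => z zr.
  rewrite scalerBr scalerA mulNr divff ?rn0 // scaleN1r opprK addrC.
  by rewrite scaleNr -alg_polyC.
move: p0; rewrite {1}Er -horner_coef0 hornerZ horner_prod.
by under eq_bigr do rewrite hornerXsubC sub0r; move=> ->; rewrite scale1r.
Qed.

End Landau.

(** * Complex power series *)

Section ComplexModulus.
Variable R : realType.
Local Notation nc := (@Normc.normc R).
Implicit Types (z w : R[i]).

Lemma normcE z : `|z| = (nc z)%:C.
Proof. by case: z. Qed.

Lemma normc_ge0 z : 0 <= nc z.
Proof. by rewrite -ler0c -normcE. Qed.

Lemma normcX z n : nc (z ^+ n) = nc z ^+ n.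
Proof.
elim: n => [|n IHn]; first by rewrite !expr0 Normc.normc1.
by rewrite !exprS Normc.normcM IHn.
Qed.

Lemma normc_real (x : R) : nc x%:C = `|x|.
Proof. by rewrite /= expr0n addr0 sqrtr_sqr. Qed.

Lemma normc_nat n : nc n%:R = n%:R.
Proof. by rewrite -(rmorph_nat (real_complex R)) normc_real normr_nat. Qed.

Lemma normc_eq0 z : (nc z == 0) = (z == 0).
Proof. by apply/eqP/eqP => [/Normc.eq0_normc//|->]; rewrite Normc.normc0. Qed.

Lemma normcB z w : nc (z - w) = nc (w - z).
Proof. by rewrite -opprB normcN. Qed.

Lemma ler_normcD z w : nc (z + w) <= nc z + nc w.
Proof. exact: le_normcD. Qed.

Lemma ler_normcB z w : nc (z - w) <= nc z + nc w.
Proof. by rewrite -(normcN w); exact: ler_normcD. Qed.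

Lemma ler_normc_sum (I : Type) (r : seq I) (P : pred I) (f : I -> R[i]) :
  nc (\sum_(i <- r | P i) f i) <= \sum_(i <- r | P i) nc (f i).
Proof.
elim/big_rec2: _ => [|i x y _ le_xy]; first by rewrite Normc.normc0.
by apply: le_trans (ler_normcD _ _) _; rewrite lerD2l.
Qed.

Lemma normc_prod (I : Type) (r : seq I) (P : pred I) (f : I -> R[i]) :
  nc (\prod_(i <- r | P i) f i) = \prod_(i <- r | P i) nc (f i).
Proof. exact: (big_morph nc (@Normc.normcM R) (Normc.normc1 R)). Qed.

Lemma ler_Re_normc z : `|complex.Re z| <= nc z.
Proof. by case: z => a b /=; rewrite -sqrtr_sqr ler_wsqrtr // lerDl sqr_ge0. Qed.

Lemma ler_Im_normc z : `|complex.Im z| <= nc z.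
Proof. by case: z => a b /=; rewrite -sqrtr_sqr ler_wsqrtr // lerDr sqr_ge0. Qed.

Lemma ler_normc_ReIm z : nc z <= `|complex.Re z| + `|complex.Im z|.
Proof.
case: z => a b /=; rewrite -[leRHS]ger0_norm ?addr_ge0 // -sqrtr_sqr ler_wsqrtr //.
rewrite sqrrD !real_normK ?num_real // addrAC lerDl.
by rewrite mulrn_wge0 // mulr_ge0.
Qed.

Lemma cvgcP (T : Type) (F : set_system T) {FF : Filter F}
    (u : T -> R[i]^o) (l : R[i]^o) :
  u x @[x --> F] --> l <->
  forall e : R, 0 < e -> \forall x \near F, nc (l - u x) < e.
Proof.
split=> [/cvgrPdist_lt cvu e e0|cvu].
  have := cvu e%:C; rewrite -[0]/(0%:C) ltcR => /(_ e0); apply: filterS => x.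
  by rewrite normcE ltcR.
apply/cvgrPdist_lt => -[e e']; rewrite ltcE /= => /andP[/eqP -> e0].
by apply: filterS (cvu e e0) => x; rewrite normcE ltcR.
Qed.

Lemma cvgc_ReIm (T : Type) (F : set_system T) {FF : Filter F}
    (u : T -> R[i]^o) (a b : R) :
  complex.Re (u x) @[x --> F] --> a -> complex.Im (u x) @[x --> F] --> b ->
  u x @[x --> F] --> (a +i* b : R[i]^o).
Proof.
move=> /cvgrPdist_lt cva /cvgrPdist_lt cvb; apply/cvgcP => e e0.
have e20 : 0 < e / 2 by rewrite divr_gt0.
apply: filterS2 (cva _ e20) (cvb _ e20) => x.
move: (u x) => w lta ltb; apply: le_lt_trans (ler_normc_ReIm _) _.
by move: w lta ltb => [c d] /= lta ltb; rewrite [e]splitr ltrD.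
Qed.

Lemma cvgc_bound (T : Type) (F : set_system T) {FF : ProperFilter F}
    (u : T -> R[i]^o) (l : R[i]^o) (M : R) :
  u x @[x --> F] --> l -> (\forall x \near F, nc (u x) <= M) -> nc l <= M.
Proof.
move=> /cvgcP cvu leM; apply/ler_addgt0Pr => e e0.
have [x [lex ltx]] := filter_ex (filterI leM (cvu e e0)).
have -> : l = u x + (l - u x) :> R[i] by rewrite addrC subrK.
by apply: le_trans (ler_normcD _ _) _; rewrite lerD // ltW.
Qed.

(** The real and imaginary parts stay in a compact segment, where every ultrafilter converges. *)
Lemma ultra_bounded_cvg (T : Type) (U : set_system T) {UU : UltraFilter U}
    (u : T -> R[i]^o) (M : R) :
  (forall x, nc (u x) <= M) -> exists l : R[i]^o, u x @[x --> U] --> l.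
Proof.
move=> leM.
have cvgR (v : T -> R) : (forall x, `|v x| <= M) -> exists l : R, v x @[x --> U] --> l.
  move=> levM; have := @segment_compact R (- M) M; rewrite compact_ultra.
  move=> /(_ (v @ U)); case.
  (* The image of an ultrafilter is maximal: a set outside it has its complement in it. *)
  - apply: Build_UltraFilter => G GF sub; apply/seteqP; split=> // A.
    move=> GA; have [//|UnA] := in_ultra_setVsetC (v @^-1` A) UU.
    have GnA : G (~` A) by apply: sub.
    have : G (A `&` ~` A) by apply: filterI.
    by rewrite setICr => /filter_not_empty.
  - by apply: nearW => x /=; rewrite in_itv /= -ler_norml.
  - by move=> l [_ cvl]; exists l.
have [a cva] := cvgR (fun x => complex.Re (u x)) (fun x => le_trans (ler_Re_normc _) (leM x)).
have [b cvb] := cvgR (fun x => complex.Im (u x)) (fun x => le_trans (ler_Im_normc _) (leM x)).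
by exists (a +i* b); apply: cvgc_ReIm.
Qed.

End ComplexModulus.

Section EntireSeries.
Variable R : realType.
Local Notation nc := (@Normc.normc R).
Implicit Types (a : nat -> R[i]) (z h : R[i]).

(** These are Cauchy's estimates at every radius, equivalent to an infinite radius of
    convergence. *)
Definition entire a :=
  forall r : R, 0 < r -> exists M : R, forall n, nc (a n) * r ^+ n <= M.

Definition psum a z (N : nat) : R[i]^o := \sum_(n < N) a n * z ^+ n.

Definition ps a z : R[i]^o := limn (psum a z).

Definition adiff a n : R[i] := n.+1%:R * a n.+1.

Lemma entire_adiff a : entire a -> entire (adiff a).
Proof.
move=> ent_a r r0.
have r20 : 0 < 2 * r by rewrite mulr_gt0.
have [M leM] := ent_a _ r20; exists (M / r) => n.
rewrite ler_pdivlMr // /adiff Normc.normcM normc_nat.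
have -> : n.+1%:R * nc (a n.+1) * r ^+ n * r = n.+1%:R * (nc (a n.+1) * r ^+ n.+1).
  by rewrite exprSr; ring.
apply: le_trans (leM n.+1); rewrite exprMn [leRHS]mulrCA.
rewrite ler_wpM2r ?mulr_ge0 ?normc_ge0 ?exprn_ge0 ?(ltW r0) //.
by rewrite -natrX ler_nat ltnW // ltn_expl.
Qed.

Lemma sum_geometric_half n : \sum_(i < n) (2^-1 : R) ^+ i <= 2.
Proof.
suff -> : \sum_(i < n) (2^-1 : R) ^+ i = 2 - 2 * 2^-1 ^+ n.
  by rewrite gerBl mulr_ge0 // exprn_ge0 // invr_ge0.
elim: n => [|n IHn]; first by rewrite big_ord0 expr0 mulr1 subrr.
by rewrite big_ord_recr /= IHn exprS; field.
Qed.

Lemma psum_cvg a z : entire a -> psum a z n @[n --> \oo] --> ps a z.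
Proof.
move=> ent_a.
(* At this radius the estimates dominate the terms at [z] by a geometric series of ratio 1/2; the
   summand 1 keeps the radius positive when [z = 0]. *)
have r0 : 0 < 2 * (nc z + 1) by rewrite mulr_gt0 // ltr_wpDl ?normc_ge0.
have [M leM] := ent_a _ r0.
have bnd n : nc (a n * z ^+ n) <= geometric M 2^-1 n.
  rewrite /geometric /= Normc.normcM normcX exprVn ler_pdivlMr ?exprn_gt0 //.
  apply: le_trans (leM n); rewrite exprMn -mulrA ler_wpM2l ?normc_ge0 // mulrC.
  rewrite ler_wpM2l ?exprn_ge0 // lerXn2r ?nnegrE ?normc_ge0 //.
    by rewrite addr_ge0 ?normc_ge0.
  by rewrite lerDl.
have cvgR (p : {additive R[i] -> R}) : (forall z, `|p z| <= nc z) ->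
    exists l : R, p (psum a z n) @[n --> \oo] --> l.
  move=> le_p.
  have cvg_s : cvgn (series (fun n => p (a n * z ^+ n))).
    apply: normed_cvg; apply: (series_le_cvg (v_ := geometric M 2^-1)) => //.
    - by move=> n /=.
    - by move=> n; exact: le_trans (normc_ge0 _) (bnd n).
    - by move=> n /=; exact: le_trans (le_p _) (bnd n).
    - by apply: is_cvg_geometric_series; rewrite ger0_norm ?invf_lt1 ?ltr1n.
  exists (limn (series (fun n => p (a n * z ^+ n)))).
  have -> : (fun n => p (psum a z n)) = series (fun n => p (a n * z ^+ n)).
    by apply/funext => n; rewrite /psum /series /= raddf_sum big_mkord.
  exact: cvg_s.
have [x cvx] := cvgR (@complex.Re R) (@ler_Re_normc R).
have [y cvy] := cvgR (@complex.Im R) (@ler_Im_normc R).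
have cv : psum a z n @[n --> \oo] --> (x +i* y : R[i]^o) by exact: cvgc_ReIm.
by rewrite /ps (cvg_lim _ cv) //; exact: norm_hausdorff.
Qed.

(** Passing from [n] to [n.+1] multiplies the remainder by [z + h] and adds [h ^+ 2] times the
    derivative of the power. The bound is geometric in [n], so it can be summed against the
    coefficients of an entire series. *)
Lemma exp_remainder z h n : nc h <= 1 ->
  nc ((z + h) ^+ n - z ^+ n - h * (n%:R * z ^+ n.-1)) <=
  nc h ^+ 2 * (2 * (nc z + 1)) ^+ n.
Proof.
move=> h1; elim: n => [|n IHn].
  by rewrite !expr0 subrr mul0r mulr0 subr0 Normc.normc0 mulr1 exprn_ge0 ?normc_ge0.
have -> : (z + h) ^+ n.+1 - z ^+ n.+1 - h * (n.+1%:R * z ^+ n.+1.-1) =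
    (z + h) * ((z + h) ^+ n - z ^+ n - h * (n%:R * z ^+ n.-1)) +
    h ^+ 2 * (n%:R * z ^+ n.-1).
  case: n {IHn} => [|n] /=; first by rewrite !expr1 !expr0; ring.
  by rewrite -[n.+2%:R]natr1 -[n.+1%:R]natr1 !exprS; ring.
apply: le_trans (ler_normcD _ _) _; rewrite !Normc.normcM !normcX normc_nat.
have zh : nc (z + h) <= nc z + 1.
  by apply: le_trans (ler_normcD _ _) _; rewrite lerD2l.
have z0 := normc_ge0 z; have h0 := normc_ge0 h; have zh0 := normc_ge0 (z + h).
apply: le_trans (lerD (ler_wpM2l zh0 IHn) (lexx _)) _.
rewrite [(2 * _) ^+ n.+1]exprS mulrCA -mulrDr ler_wpM2l ?exprn_ge0 //.
have X0 : 0 <= (2 * (nc z + 1)) ^+ n by rewrite exprn_ge0 // mulr_ge0 // addr_ge0.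
have le2 : n%:R * nc z ^+ n.-1 <= (nc z + 1) * (2 * (nc z + 1)) ^+ n.
  case: n {IHn} X0 => [|n] X0 /=; first by rewrite mul0r mulr_ge0 // addr_ge0.
  rewrite exprMn mulrCA ler_pM // ?exprn_ge0 //.
    by rewrite -natrX ler_nat ltnW // ltn_expl.
  rewrite exprS -[leLHS]mul1r mulrA ler_pM ?exprn_ge0 //.
    by rewrite -expr2 exprn_ege1 // lerDr.
  by rewrite lerXn2r ?nnegrE ?addr_ge0 // lerDl.
apply: le_trans (lerD (ler_wpM2r X0 zh) le2) _.
by rewrite le_eqVlt; apply/orP; left; apply/eqP; ring.
Qed.

Lemma psum_adiff a z N :
  psum (adiff a) z N = \sum_(n < N.+1) a n * (n%:R * z ^+ n.-1).
Proof.
rewrite big_ord_recl mul0r mulr0 add0r; apply: eq_bigr => i _.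
by rewrite lift0 /adiff /= mulrCA mulrA.
Qed.

Lemma derive1_ps a : entire a -> derive1 (ps a) = ps (adiff a).
Proof.
move=> ent_a; apply/funext => z.
(* The inner factor matches the growth in [exp_remainder]; the outer 2 leaves a geometric series of
   sum at most 2. *)
have r0 : 0 < 2 * (2 * (nc z + 1)) by rewrite !mulr_gt0 // ltr_wpDl ?normc_ge0.
have [M leM] := ent_a _ r0.
have M0 : 0 <= M.
  by apply: le_trans (leM 0%N); rewrite expr0 mulr1 normc_ge0.
have bnd h : nc h <= 1 ->
    nc (ps a (h + z) - ps a z - h * ps (adiff a) z) <= nc h ^+ 2 * (M * 2).
  move=> h1.
  have cv : (psum a (h + z) n.+1 - psum a z n.+1 - (h : R[i]^o) * psum (adiff a) z n)
     @[n --> \oo] --> (ps a (h + z) - ps a z - (h : R[i]^o) * ps (adiff a) z : R[i]^o).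
    apply: cvgB.
      by apply: cvgB; rewrite (cvg_shiftS (psum a _)); apply: psum_cvg.
    by apply: cvgM; [apply: cvg_cst | apply/psum_cvg/entire_adiff].
  apply: (cvgc_bound cv); apply: nearW => N.
  rewrite psum_adiff /psum mulr_sumr -!sumrB.
  apply: le_trans (ler_normc_sum _ _ _) _.
  apply: (@le_trans _ _ (\sum_(n < N.+1) nc h ^+ 2 * (M * 2^-1 ^+ n))).
    apply: ler_sum => n _.
    have -> : a n * (h + z) ^+ n - a n * z ^+ n - h * (a n * (n%:R * z ^+ n.-1)) =
        a n * ((z + h) ^+ n - z ^+ n - h * (n%:R * z ^+ n.-1)).
      by rewrite [h + z]addrC; ring.
    rewrite Normc.normcM.
    apply: le_trans (ler_wpM2l (normc_ge0 _) (exp_remainder _ _ h1)) _.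
    rewrite mulrCA ler_wpM2l ?exprn_ge0 ?normc_ge0 //.
    by rewrite exprVn ler_pdivlMr ?exprn_gt0 // -mulrA mulrC -exprMn [_ * 2]mulrC mulrC.
  rewrite -!mulr_sumr ler_wpM2l ?exprn_ge0 ?normc_ge0 //.
  by rewrite ler_wpM2l // sum_geometric_half.
apply: cvg_lim; first exact: norm_hausdorff.
apply/cvgcP => e e0.
(* The bound 1 makes the remainder estimate applicable; the other turns it into [e], with [+ 1]
   guarding against [M = 0]. *)
have d0 : 0 < Num.min 1 (e / (M * 2 + 1)).
  by rewrite lt_min ltr01 divr_gt0 // ltr_wpDl ?mulr_ge0.
have : \forall h \near (0 : R[i]^o)^', `|h| < (Num.min 1 (e / (M * 2 + 1)))%:C.
  by apply: dnbhs0_lt; rewrite -[0]/(0%:C) ltcR.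
have : \forall h \near (0 : R[i]^o)^', h != 0 by apply: nbhs_dnbhs_neq.
apply: filterS2 => h hn0; rewrite normcE ltcR lt_min => /andP[h1 he].
have -> : ps (adiff a) z - h^-1 *: (ps a (h + z) - ps a z) =
    - h^-1 * (ps a (h + z) - ps a z - h * ps (adiff a) z).
  rewrite -[_ *: _]/(h^-1 * _).
  move: (ps a (h + z)) (ps a z) (ps _ _) => x y w.
  by apply: (mulfI (x := h)) => //; rewrite -[h]/(h : R[i]); field.
rewrite Normc.normcM normcN Normc.normcV.
have h0 : 0 < nc h by rewrite lt_neqAle eq_sym normc_eq0 hn0 normc_ge0.
rewrite mulrC ltr_pdivrMr //; apply: le_lt_trans (bnd _ (ltW h1)) _.
have he' : nc h * (M * 2 + 1) < e by rewrite -ltr_pdivlMr // ltr_wpDl ?mulr_ge0.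
rewrite expr2 -mulrA [ltRHS]mulrC ltr_pM2l //.
by apply: le_lt_trans he'; rewrite ler_wpM2l ?normc_ge0 // lerDl.
Qed.

Lemma entire_iter_adiff a i : entire a -> entire (iter i adiff a).
Proof. by move=> ent_a; elim: i => //= i; apply: entire_adiff. Qed.

Lemma derive1n_ps a i : entire a -> derive1n i (ps a) = ps (iter i adiff a).
Proof.
move=> ent_a; elim: i => // i IHi.
by rewrite /derive1n iterS -/(derive1n i (ps a)) IHi derive1_ps //; apply: entire_iter_adiff.
Qed.

Lemma horner_poly_psum a N z : (\poly_(n < N) a n).[z] = psum a z N.
Proof. by rewrite horner_poly. Qed.

Lemma derivn_poly a N i :
  (\poly_(n < N) a n)^`(i) = \poly_(n < N - i) iter i adiff a n.
Proof.
elim: i => [|i IHi]; first by rewrite derivn0 subn0.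
rewrite derivnS IHi; apply/polyP => k; rewrite coef_deriv !coef_poly /= subnS.
rewrite -ltn_predRL; case: ltnP => _; last by rewrite mul0rn.
by rewrite /adiff mulr_natl.
Qed.

Lemma cvg_derivn_poly a i z : entire a ->
  (((\poly_(n < N) a n)^`(i)).[z] : R[i]^o) @[N --> \oo] -->
  (derive1n i (ps a) z : R[i]^o).
Proof.
move=> ent_a; rewrite derive1n_ps //.
have -> : (fun N => ((\poly_(n < N) a n)^`(i)).[z]) =
    [sequence psum (iter i adiff a) z (N - i)%N]_N.
  by apply/funext => N; rewrite derivn_poly horner_poly_psum.
by rewrite cvg_centern; apply/psum_cvg/entire_iter_adiff.
Qed.

End EntireSeries.

(** * Zeros of an entire function as limits of zeros of its truncations *)

Section ReciprocalRoots.
Variable R : realType.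
Local Notation nc := (@Normc.normc R).
Implicit Types (c : nat -> R[i]) (w : R[i]).

Lemma sum_sqr_le (n : nat) (t : nat -> R) : (forall i, 0 <= t i) ->
  \sum_(i < n) t i ^+ 2 <= (\sum_(i < n) t i) ^+ 2.
Proof.
move=> t0; elim: n => [|n IHn]; first by rewrite !big_ord0 expr0n.
rewrite !big_ord_recr /= sqrrD.
rewrite lerD2r; apply: le_trans IHn _; rewrite lerDl mulrn_wge0 // mulr_ge0 //.
by apply: sumr_ge0.
Qed.

Lemma sum_exp_coeff_le (x : R) N : 0 <= x ->
  \sum_(k < N) x ^+ k / k`!%:R <= expR x.
Proof.
move=> x0.
have -> : \sum_(k < N) x ^+ k / k`!%:R = series (exp_coeff x) N.
  by rewrite /series /= big_mkord.
rewrite /expR; apply: nondecreasing_cvgn_le; last exact: is_cvg_series_exp_coeff.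
by apply: nondecreasing_series => n _ _; apply: exp_coeff_ge0.
Qed.

Let by_modulus : rel R[i] := fun z w => nc w <= nc z.

Lemma exists_reciprocal_roots c N : c 0%N = 1 ->
  exists s : seq R[i], [/\ \poly_(k < N.+1) c k = \prod_(w <- s) (1 - w *: 'X),
    (size s <= N)%N & sorted by_modulus s].
Proof.
move=> c0; have p0 : (\poly_(k < N.+1) c k)`_0 = 1 by rewrite coef_poly.
have [s Es les] := factor_at_one p0; exists (sort by_modulus s); split.
- by rewrite Es; apply: perm_big; rewrite perm_sym perm_sort.
- rewrite size_sort (leq_trans les) // -subn1 leq_subLR add1n.
  exact: size_poly.
- by apply: sort_sorted => z w; apply: le_total.
Qed.

(** Landau's inequality is applied to the polynomial rescaled by [r], and the quadratic norm is
    bounded by the sum of the moduli. *)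
Lemma landau_real (c : nat -> R[i]) N (s1 s2 : seq R[i]) (r : R) : 0 < r ->
  \poly_(k < N.+1) c k = \prod_(w <- s1 ++ s2) (1 - w *: 'X) ->
  \prod_(w <- s1) (r * nc w) <= \sum_(k < N.+1) r ^+ k * nc (c k).
Proof.
move=> r0 Ep.
have S0 : 0 <= \sum_(k < N.+1) r ^+ k * nc (c k).
  by apply: sumr_ge0 => k _; rewrite mulr_ge0 ?normc_ge0 ?exprn_ge0 ?ltW.
have P0 : 0 <= \prod_(w <- s1) (r * nc w).
  by apply: prodr_ge0 => w _; rewrite mulr_ge0 ?normc_ge0 ?ltW.
rewrite -ler_sqr ?nnegrE //.
apply: le_trans (@sum_sqr_le _ (fun k => r ^+ k * nc (c k)) _); last first.
  by move=> k; rewrite mulr_ge0 ?normc_ge0 ?exprn_ge0 ?ltW.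
have := landau_inequality (map (fun w => r%:C * w) s1) (map (fun w => r%:C * w) s2).
rewrite -map_cat !big_map.
rewrite (@l2norm2_widen _ N.+1); last first.
  apply/leq_sizeP => j ltj; rewrite -(big_map _ xpredT (fun w => 1 - w *: 'X)).
  by rewrite big_map coef_prod_scale -Ep coef_poly ltnNge ltj mulr0.
have -> : \sum_(i < N.+1) `|(\prod_(w <- s1 ++ s2) (1 - (r%:C * w) *: 'X))`_i| ^+ 2
    = (\sum_(i < N.+1) (r ^+ i * nc (c i)) ^+ 2)%:C.
  rewrite raddf_sum; apply: eq_bigr => i _.
  rewrite coef_prod_scale -Ep coef_poly ltn_ord normcE -rmorphXn; congr (_ ^+ 2)%:C.
  by rewrite Normc.normcM normcX normc_real ger0_norm // ltW.
have -> : \prod_(w <- s1) `|r%:C * w| ^+ 2 = ((\prod_(w <- s1) (r * nc w)) ^+ 2)%:C.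
  rewrite -prodrXl rmorph_prod; apply: eq_bigr => w _.
  by rewrite normcE -rmorphXn Normc.normcM normc_real ger0_norm // ltW.
by rewrite lecR.
Qed.

(** The [i.+1] largest roots all have modulus at least that of [s]_i[, so Landau's inequality bounds
    a power of]r * nc s[_i]; an [i.+1]-th root is then taken. The quadratic decay comes from the
    squared factorial in the hypothesis. *)
Lemma reciprocal_root_bound c N (s : seq R[i]) (C A : R) i : 1 <= C -> 0 < A ->
  (forall k, nc (c k) <= C * A ^+ k / k`!%:R ^+ 2) ->
  \poly_(k < N.+1) c k = \prod_(w <- s) (1 - w *: 'X) -> sorted by_modulus s ->
  nc s`_i <= A * C * expR 1 ^+ 2 / i.+1%:R ^+ 2.
Proof.
move=> C1 A0 le_c Ep sorted_s.
have C0 : 0 < C by apply: lt_le_trans C1.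
have [lt_is|le_si] := ltnP i (size s); last first.
  by rewrite nth_default // Normc.normc0 divr_ge0 ?exprn_ge0 ?mulr_ge0 ?expR_ge0 ?ltW.
set x : R := i.+1%:R; have x0 : 0 < x by rewrite ltr0n.
(* With this [r] the sum is at most [C] times the square of the exponential series at [x = i.+1],
   that is [C * expR 1 ^+ (2 * i.+1)]. *)
pose r := x ^+ 2 / A; have r0 : 0 < r by rewrite divr_gt0 // exprn_gt0.
have := @landau_real c N (take i.+1 s) (drop i.+1 s) r r0.
rewrite cat_take_drop => /(_ Ep) le_prod.
have le1 : (r * nc s`_i) ^+ i.+1 <= \prod_(w <- take i.+1 s) (r * nc w).
  rewrite (big_nth 0) size_takel // -[X in _ ^+ X](subn0 i.+1) -prodr_const_nat.
  rewrite big_nat [leRHS]big_nat; apply: ler_prod => j /andP[_ lt_ji].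
  rewrite mulr_ge0 ?normc_ge0 ?(ltW r0) //= ler_wpM2l ?(ltW r0) // nth_take //.
  apply: (sorted_leq_nth _ _ 0 sorted_s).
  - by move=> y z w; rewrite /by_modulus => h1 h2; apply: le_trans h2 h1.
  - by move=> y; apply: lexx.
  - by rewrite inE (leq_ltn_trans _ lt_is).
  - by [].
  - by rewrite -ltnS.
have le2 : \sum_(k < N.+1) r ^+ k * nc (c k) <= (C * expR 1 ^+ 2) ^+ i.+1.
  apply: (@le_trans _ _ (C * (\sum_(k < N.+1) x ^+ k / k`!%:R) ^+ 2)).
    apply: (@le_trans _ _ (C * (\sum_(k < N.+1) (x ^+ k / k`!%:R) ^+ 2))).
      rewrite mulr_sumr; apply: ler_sum => k _.
      apply: le_trans (ler_wpM2l _ (le_c k)) _; first by rewrite exprn_ge0 // ltW.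
      have h : k`!%:R != 0 :> R by rewrite pnatr_eq0 -lt0n fact_gt0.
      have hA : A ^+ k != 0 by rewrite expf_neq0 // gt_eqF.
      rewrite /r !expr_div_n -!exprM mulnC exprM le_eqVlt; apply/orP; left.
      by apply/eqP; field; rewrite h hA.
    rewrite ler_wpM2l ?(ltW C0) // (@sum_sqr_le _ (fun k => x ^+ k / k`!%:R)) //.
    by move=> k; rewrite divr_ge0 // exprn_ge0 // ltW.
  rewrite exprMn; apply: ler_pM.
  - exact: ltW.
  - by rewrite sqr_ge0.
  - by rewrite -[leLHS]expr1 ler_weXn2l.
  rewrite -exprM mulnC exprM ler_sqr ?nnegrE.
  - by rewrite -expRM_natl mulr1; apply: sum_exp_coeff_le; apply: ltW.
  - by apply: sumr_ge0 => k _; rewrite divr_ge0 // exprn_ge0 // ltW.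
  - by rewrite exprn_ge0 // expR_ge0.
have := le_trans le1 (le_trans le_prod le2).
rewrite ler_pXn2r ?nnegrE //; first last.
- by rewrite mulr_ge0 ?exprn_ge0 ?expR_ge0 ?ltW.
- by rewrite mulr_ge0 ?normc_ge0 ?ltW.
rewrite /r -mulrA mulrC -ler_pdivlMr ?exprn_gt0 //.
rewrite mulrC ler_pdivrMr // => /le_trans; apply.
by rewrite le_eqVlt; apply/orP; left; apply/eqP; field; rewrite gt_eqF.
Qed.

End ReciprocalRoots.

Section LimitLemmas.
Variable R : realType.
Local Notation nc := (@Normc.normc R).

Lemma cvgc_sum (T : Type) (F : set_system T) {FF : Filter F} (n : nat)
    (u : nat -> T -> R[i]^o) (l : nat -> R[i]^o) :
  (forall i, (i < n)%N -> u i x @[x --> F] --> l i) ->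
  (\sum_(i < n) u i x) @[x --> F] --> \sum_(i < n) l i.
Proof.
elim: n => [|n IHn] cvu.
  by rewrite big_ord0; under eq_fun do rewrite big_ord0; apply: cvg_cst.
rewrite big_ord_recr /=; under eq_fun do rewrite big_ord_recr /=.
by apply: cvgD; [apply: IHn => i lt_in; apply/cvu/ltnW | apply: cvu].
Qed.

Lemma cvgcX (T : Type) (F : set_system T) {FF : Filter F} (n : nat)
    (u : T -> R[i]^o) (l : R[i]^o) :
  u x @[x --> F] --> l -> (u x ^+ n : R[i]^o) @[x --> F] --> (l ^+ n : R[i]^o).
Proof.
move=> cvu; elim: n => [|n IHn].
  by rewrite expr0; under eq_fun do rewrite expr0; apply: cvg_cst.
have -> : (fun x => (u x ^+ n.+1 : R[i]^o)) = u \* (fun x => (u x ^+ n : R[i]^o)).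
  by apply/funext => x; rewrite exprS.
by rewrite exprS; exact: cvgM cvu IHn.
Qed.

Lemma cvgcMn (T : Type) (F : set_system T) {FF : Filter F} (n : nat)
    (u : T -> R[i]^o) (l : R[i]^o) :
  u x @[x --> F] --> l -> (u x *+ n : R[i]^o) @[x --> F] --> (l *+ n : R[i]^o).
Proof.
move=> cvu; elim: n => [|n IHn]; first exact: cvg_cst.
have -> : (fun x => (u x *+ n.+1 : R[i]^o)) = u \+ (fun x => (u x *+ n : R[i]^o)).
  by apply/funext => x; rewrite mulrS.
by rewrite mulrS; exact: cvgD cvu IHn.
Qed.

Lemma cvgc_unique (T : Type) (F : set_system T) {FF : ProperFilter F}
    (u : T -> R[i]^o) (l l' : R[i]^o) :
  u x @[x --> F] --> l -> u x @[x --> F] --> l' -> l = l'.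
Proof. by apply: cvg_unique; exact: norm_hausdorff. Qed.

Lemma cvgc_lower_bound (T : Type) (F : set_system T) {FF : ProperFilter F}
    (u : T -> R[i]^o) (l : R[i]^o) (m : R) :
  u x @[x --> F] --> l -> (\forall x \near F, m <= nc (u x)) -> m <= nc l.
Proof.
move=> /cvgcP cvu le_m; apply/ler_addgt0Pr => e e0.
have [x [lex ltx]] := filter_ex (filterI le_m (cvu e e0)).
apply: (le_trans lex); have -> : u x = l + (u x - l) :> R[i] by rewrite addrC subrK.
by apply: le_trans (ler_normcD _ _) _; rewrite lerD2l normcB ltW.
Qed.

(** Telescoping comparison with [1 / i - 1 / (i + 1)]. *)
Lemma sum_inv_sqr_tail (K N : nat) : (0 < K)%N ->
  \sum_(K <= i < N) (i.+1%:R ^+ 2)^-1 <= K%:R^-1 :> R.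
Proof.
move=> K0; have [le_NK|/ltnW/subnKC <-] := leqP N K.
  by rewrite big_geq // invr_ge0.
apply: (@le_trans _ _ (K%:R^-1 - (K + (N - K))%:R^-1)); last by rewrite gerBl invr_ge0.
elim: (N - K)%N => [|d IHd]; first by rewrite addn0 big_geq // subrr.
rewrite addnS big_nat_recr ?leq_addr //=.
apply: le_trans (lerD IHd (lexx _)) _; rewrite -addrA lerD2l.
have x0 : 0 < (K + d)%:R :> R by rewrite ltr0n addn_gt0 K0.
rewrite -natr1; move: ((K + d)%:R) x0 => x x0.
have x1 : 0 < x + 1 by rewrite addr_gt0.
suff: ((x + 1) ^+ 2)^-1 <= x^-1 - (x + 1)^-1.
  by move: (_^-1) (_^-1) (_^-1) => u v w; lra.
have -> : x^-1 - (x + 1)^-1 = (x * (x + 1))^-1 by field; rewrite !gt_eqF.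
by rewrite lef_pV2 ?posrE ?mulr_gt0 ?exprn_gt0 // expr2 ler_pM2r // lerDl.
Qed.

Lemma prod_1B_ge (t : nat -> R) (m n : nat) : (forall i, (m <= i)%N -> 0 <= t i <= 1) ->
  1 - \sum_(m <= i < n) t i <= \prod_(m <= i < n) (1 - t i).
Proof.
move=> t01; have [le_nm|/ltnW/subnKC <-] := leqP n m; first by rewrite !big_geq // subr0.
elim: (n - m)%N => [|d IHd]; first by rewrite addn0 !big_geq // subr0.
rewrite addnS !big_nat_recr ?leq_addr //=.
have /andP[t0 t1] := t01 _ (leq_addr d m).
have S0 : 0 <= \sum_(m <= i < m + d) t i.
  by rewrite big_nat; apply: sumr_ge0 => i /andP[le_mi _]; case/andP: (t01 _ le_mi).
apply: le_trans (ler_wpM2r _ IHd); last by rewrite subr_ge0.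
by move: (\sum_(_ <= _ < _) _) (t _) S0 t0 => S x S0 x0; nra.
Qed.

Lemma cvg_coef_prod (T : Type) (F : set_system T) {FF : Filter F}
    (p q : T -> {poly R[i]}) (l l' : nat -> R[i]) j :
  (forall i, ((p x)`_i : R[i]^o) @[x --> F] --> (l i : R[i]^o)) ->
  (forall i, ((q x)`_i : R[i]^o) @[x --> F] --> (l' i : R[i]^o)) ->
  ((p x * q x)`_j : R[i]^o) @[x --> F] --> (conv l l' j : R[i]^o).
Proof.
move=> cvp cvq; under eq_fun do rewrite coefM.
apply: (@cvgc_sum _ _ _ j.+1 (fun i x => (p x)`_i * (q x)`_(j - i))
  (fun i => l i * l' (j - i)%N)) => i _.
exact: cvgM (cvp i) (cvq (j - i)%N).
Qed.

Lemma coef_comp_shift (p : {poly R[i]}) z j :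
  (p \Po ('X + z%:P))`_j *+ j`! = (p^`(j)).[z].
Proof.
have E n : (p \Po ('X + z%:P))^`(n) = p^`(n) \Po ('X + z%:P).
  elim: n => // n IHn; rewrite !derivnS IHn deriv_comp derivD derivX derivC addr0.
  by rewrite mulr1.
have := coef_derivn j (p \Po ('X + z%:P)) 0.
rewrite addn0 ffactnn E -horner_coef0 horner_comp => <-.
by rewrite hornerD hornerX hornerC add0r.
Qed.

End LimitLemmas.

Section LimitRoots.
Variables (R : realType) (c : nat -> R[i]) (C A : R).
Local Notation nc := (@Normc.normc R).
Hypothesis c0 : c 0%N = 1.
Hypothesis C_ge1 : 1 <= C.
Hypothesis A_gt0 : 0 < A.
Hypothesis c_bound : forall k, nc (c k) <= C * A ^+ k / k`!%:R ^+ 2.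

Let M : R := A * C * expR 1 ^+ 2.

(** Padding each root list with the default value 0 gives the truncation exactly [N] factors, those
    of the added roots being 1. *)
Lemma truncation_roots : exists b : nat -> nat -> R[i], forall N,
  \poly_(k < N.+1) c k = \prod_(i < N) (1 - b N i *: 'X) /\
  forall i, nc (b N i) <= M / i.+1%:R ^+ 2.
Proof.
suff: forall N, exists b : nat -> R[i],
  \poly_(k < N.+1) c k = \prod_(i < N) (1 - b i *: 'X) /\
  forall i, nc (b i) <= M / i.+1%:R ^+ 2.
  by move=> H; have [b Hb] := choice H; exists b.
move=> N; have [s [Es les sorted_s]] := exists_reciprocal_roots N c0.
exists (fun i => s`_i); split; last first.
  by move=> i; apply: (reciprocal_root_bound _ C_ge1 A_gt0 c_bound Es sorted_s).
rewrite Es (big_nth 0) big_mkord (big_ord_widen N (fun i => 1 - s`_i *: 'X)) //.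
rewrite big_mkcond; apply: eq_bigr => i _; case: ltnP => // lei.
by rewrite nth_default // scale0r subr0.
Qed.

(** The first [N] Newton identities involve only coefficients that the truncation shares with the
    series, so these power sums do not depend on [N]. *)
Lemma truncation_power_sum (b s : nat -> R[i]) N j :
  (forall k, conv s c k = - (k.+1%:R * c k.+1)) ->
  \poly_(k < N.+1) c k = \prod_(i < N) (1 - b i *: 'X) ->
  (j < N)%N -> \sum_(i < N) b i ^+ j.+1 = s j.
Proof.
move=> Es Eb; move: j.
pose t := [seq b i | i <- iota 0 N].
have Et : \poly_(k < N.+1) c k = \prod_(w <- t) (1 - w *: 'X).
  by rewrite Eb big_map -[N in iota 0 N]subn0 -/(index_iota 0 N) big_mkord.
suff H k : (k < N)%N -> conv (fun j => \sum_(w <- t) w ^+ j.+1) c k = conv s c k.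
  move=> j /(conv_inj_upto c0 H) <-.
  by rewrite big_map -[N in iota 0 N]subn0 -/(index_iota 0 N) big_mkord.
move=> ltk; have := newton_identity k Et; rewrite coef_poly ltnS ltk -Es => <-.
apply: eq_bigr => i _; rewrite coef_poly ltnS (leq_trans (leq_subr _ _)) //.
exact: ltnW.
Qed.

End LimitRoots.

(** * Limits of the reciprocal roots along an ultrafilter, and orders of zeros *)

Section UltraLimit.
Variables (R : realType) (c : nat -> R[i]) (b : nat -> nat -> R[i]) (M : R).
Variables (U : set_system nat) (UU : UltraFilter U) (beta : nat -> R[i]).
Local Notation nc := (@Normc.normc R).
Hypothesis c0 : c 0%N = 1.
Hypothesis b_prod : forall N,
  \poly_(k < N.+1) c k = \prod_(i < N) (1 - b N i *: 'X).
Hypothesis b_bound : forall N i, nc (b N i) <= M / i.+1%:R ^+ 2.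
Hypothesis sub_U : \oo `<=` U.
Hypothesis cvg_b : forall i, (b N i : R[i]^o) @[N --> U] --> (beta i : R[i]^o).

Let M_ge0 : 0 <= M.
Proof.
have := le_trans (normc_ge0 _) (b_bound 0 0).
by rewrite expr1n divr1.
Qed.

Lemma cvg_oo_ultra (u : nat -> R[i]^o) (l : R[i]^o) :
  u N @[N --> \oo] --> l -> u N @[N --> U] --> l.
Proof. by move=> cvu B nB; apply: sub_U; apply: cvu. Qed.

Lemma limit_root_bound i : nc (beta i) <= M / i.+1%:R ^+ 2.
Proof. by apply: (cvgc_bound (@cvg_b i)); apply: nearW => N; apply: b_bound. Qed.

Lemma sum_bound_tail (t : nat -> R) (B : R) K N : 0 <= B -> (0 < K)%N ->
  (forall i, t i <= B / i.+1%:R ^+ 2) -> \sum_(K <= i < N) t i <= B / K%:R.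
Proof.
move=> B0 K0 le_t.
apply: (@le_trans _ _ (\sum_(K <= i < N) B * (i.+1%:R ^+ 2)^-1)).
  by apply: ler_sum => i _; apply: le_t.
by rewrite -mulr_sumr ler_wpM2l // sum_inv_sqr_tail.
Qed.

Lemma root_power_bound (w : R[i]) i j : nc w <= M / i.+1%:R ^+ 2 ->
  nc (w ^+ j.+1) <= M ^+ j.+1 / i.+1%:R ^+ 2.
Proof.
move=> le_w; rewrite normcX; apply: (@le_trans _ _ ((M / i.+1%:R ^+ 2) ^+ j.+1)).
  by rewrite lerXn2r ?nnegrE ?normc_ge0 ?divr_ge0 ?exprn_ge0.
rewrite expr_div_n ler_wpM2l ?exprn_ge0 // lef_pV2 ?posrE ?exprn_gt0 ?ltr0n //.
by rewrite -[leLHS]expr1 ler_weXn2l // exprn_ege1 // ler1n.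
Qed.

Lemma limit_root_power_sum (s : nat -> R[i]) K j : (0 < K)%N ->
  (forall k, conv s c k = - (k.+1%:R * c k.+1)) ->
  nc (\sum_(i < K) beta i ^+ j.+1 - s j) <= M ^+ j.+1 / K%:R.
Proof.
move=> K0 Es.
have cv : (\sum_(i < K) b N i ^+ j.+1 - s j : R[i]^o) @[N --> U] -->
    (\sum_(i < K) beta i ^+ j.+1 - s j : R[i]^o).
  apply: cvgB; last exact: cvg_cst.
  apply: (@cvgc_sum _ _ _ _ K (fun i N => b N i ^+ j.+1) (fun i => beta i ^+ j.+1)).
  by move=> i _; apply: cvgcX.
apply: (cvgc_bound cv).
(* For such [N] the full sum over the roots of the truncation equals [s j], so the difference is a
   tail, bounded uniformly in [N]. *)
have : U [set N | (maxn K j.+1 <= N)%N] by apply: sub_U; exists (maxn K j.+1).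
apply: filterS => N /=; rewrite geq_max => /andP[le_KN lt_jN].
rewrite -(truncation_power_sum c0 Es (b_prod N) lt_jN).
rewrite -(big_mkord xpredT (fun i => b N i ^+ j.+1)).
rewrite -[X in _ - X](big_mkord xpredT (fun i => b N i ^+ j.+1)).
rewrite [X in _ - X](big_cat_nat (n := K)) //= opprD addNKr normcN.
apply: le_trans (ler_normc_sum _ _ _) _.
apply: (sum_bound_tail (t := fun i => nc (b N i ^+ j.+1))) => // [|i].
  by rewrite exprn_ge0.
exact: root_power_bound.
Qed.

Section Order.
Variable z : R[i].

(** The factor [1 - w x ^ 2] recentred at [z], so that coefficients are Taylor coefficients at
    [z]. *)
Let quad (w : R[i]) : {poly R[i]} := 1 - w *: ('X + z%:P) ^+ 2.
Let nzeros K := (\sum_(i < K) (beta i * z ^+ 2 == 1)%R)%N.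

Lemma coef_quad w k : (quad w)`_k = (1 : {poly R[i]})`_k - w * (('X + z%:P) ^+ 2)`_k.
Proof. by rewrite coefB coefZ. Qed.

Lemma coef_quadM w (p : {poly R[i]}) k : (quad w * p)`_k =
  (1 - w * z ^+ 2) * p`_k - (2 * w * z) * (if k is k1.+1 then p`_k1 else 0) -
  w * (if k is k2.+2 then p`_k2 else 0).
Proof.
have -> : quad w * p = (1 - w * z ^+ 2) *: p - (2 * w * z) *: ('X * p) -
    w *: ('X * ('X * p)).
  rewrite /quad -!mul_polyC !polyCB !polyCM polyC_natr polyC1.
  by ring.
by rewrite !coefB !coefZ !coefXM; case: k => [|[|k]] //=; rewrite coefXM.
Qed.

Lemma comp_prod_linear (w : nat -> R[i]) n :
  (\prod_(i < n) (1 - w i *: 'X)) \Po ('X + z%:P) ^+ 2 = \prod_(i < n) quad (w i).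
Proof.
elim: n => [|n IHn]; first by rewrite !big_ord0 comp_polyC.
rewrite !big_ord_recr /= comp_polyM IHn comp_polyB comp_polyZ comp_polyX.
by rewrite comp_polyC.
Qed.

(** The zero at [z] is simple: the linear coefficient is [- 2 w z], and [w z ^ 2 = 1] excludes
    [w = 0] and [z = 0]. *)
Lemma quad_zero w : w * z ^+ 2 = 1 -> exists2 q, quad w = 'X * q & q`_0 != 0.
Proof.
move=> wz; exists (- (2 * w * z)%:P - w *: 'X); last first.
  rewrite coefB coefN coefC coefZ coefX mulr0 subr0 oppr_eq0 !mulf_neq0 ?pnatr_eq0 //.
    by apply: contra_eq_neq wz => ->; rewrite mul0r eq_sym oner_eq0.
  by apply: contra_eq_neq wz => ->; rewrite expr0n mulr0 eq_sym oner_eq0.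
rewrite /quad -!mul_polyC !polyCM polyC_natr.
have E : w%:P * z%:P ^+ 2 = 1 by rewrite -polyC_exp -polyCM wz polyC1.
transitivity (1 - w%:P * z%:P ^+ 2 + 'X * (- (2 * w%:P * z%:P) - w%:P * 'X)).
  by ring.
by rewrite E subrr add0r.
Qed.

Lemma head_valuation K : exists2 q,
  \prod_(i < K) quad (beta i) = 'X^(nzeros K) * q & q`_0 != 0.
Proof.
elim: K => [|K [q Eq q0]].
  by exists 1; rewrite ?coef1 ?oner_eq0 // /nzeros !big_ord0 mulr1.
rewrite /nzeros !big_ord_recr /= Eq; have [wz|nwz] := eqVneq.
  have [q' -> q'0] := quad_zero wz; exists (q * q'); last first.
    by rewrite coefM big_ord1 mulf_neq0.
  by rewrite addn1 exprSr; ring.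
exists (q * quad (beta K)); first by rewrite addn0 mulrA.
rewrite coefM big_ord1 mulf_neq0 // -[quad _]mulr1 coef_quadM coef1 mulr1 !mulr0 !subr0.
by rewrite subr_eq0 eq_sym.
Qed.

Lemma cvg_coef_head K k : ((\prod_(i < K) quad (b N i))`_k : R[i]^o) @[N --> U] -->
  ((\prod_(i < K) quad (beta i))`_k : R[i]^o).
Proof.
elim: K k => [|K IHK] k.
  by rewrite big_ord0; under eq_fun do rewrite big_ord0; apply: cvg_cst.
rewrite big_ord_recr /= coefM.
have -> : (fun N => ((\prod_(i < K.+1) quad (b N i))`_k : R[i]^o)) =
    (fun N => ((\prod_(i < K) quad (b N i)) * quad (b N K))`_k : R[i]^o).
  by apply/funext => N; rewrite big_ord_recr.
apply: (@cvg_coef_prod R _ U _ _ _ (fun k => (\prod_(i < K) quad (beta i))`_k)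
  (fun k => (quad (beta K))`_k) k IHK) => i.
rewrite coef_quad; under eq_fun do rewrite coef_quad.
by apply: cvgB; [apply: cvg_cst | apply: cvgM; [apply: cvg_b | apply: cvg_cst]].
Qed.

Lemma sum_shift_le (t : nat -> R) n : (forall k, 0 <= t k) ->
  \sum_(k < n) (if val k is k1.+1 then t k1 else 0) <= \sum_(k < n) t k.
Proof.
move=> t0; case: n => [|n]; first by rewrite !big_ord0.
by rewrite big_ord_recl add0r big_ord_recr /= lerDl.
Qed.

(** The sum of the moduli of the coefficients is submultiplicative, and for [quad w] it is at most
    [1 + nc w * (nc z + 1) ^+ 2]. *)
Lemma l1_quadM w (p : {poly R[i]}) n : \sum_(k < n) nc (quad w * p)`_k <=
  (1 + nc w * (nc z + 1) ^+ 2) * \sum_(k < n) nc p`_k.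
Proof.
pose t k := nc p`_k; pose t1 k := if k is k1.+1 then t k1 else 0.
pose t2 k := if k is k1.+1 then t1 k1 else 0.
have t_ge0 k : 0 <= t k by apply: normc_ge0.
have t1_ge0 k : 0 <= t1 k by case: k => //= k; apply: t_ge0.
have le1 : \sum_(k < n) t1 k <= \sum_(k < n) t k by apply: sum_shift_le.
have le2 : \sum_(k < n) t2 k <= \sum_(k < n) t k.
  by apply: le_trans le1; apply: sum_shift_le.
have w0 := normc_ge0 w; have z0 := normc_ge0 z.
apply: (@le_trans _ _ (\sum_(k < n) ((1 + nc w * nc z ^+ 2) * t k +
    (2 * nc w * nc z) * t1 k + nc w * t2 k))).
  apply: ler_sum => k _; rewrite coef_quadM.
  apply: le_trans (ler_normcB _ _) _; apply: lerD; last first.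
    rewrite Normc.normcM ler_wpM2l //.
    by case: (nat_of_ord k) => [|[|k2]]; rewrite ?Normc.normc0.
  apply: le_trans (ler_normcB _ _) _; apply: lerD.
    rewrite Normc.normcM ler_wpM2r ?normc_ge0 //.
    by apply: le_trans (ler_normcB _ _) _; rewrite Normc.normc1 Normc.normcM normcX.
  rewrite !Normc.normcM normc_nat ler_wpM2l ?mulr_ge0 //.
  by case: (nat_of_ord k) => [|k1]; rewrite ?Normc.normc0.
rewrite !big_split -!mulr_sumr /=.
have h1 : 0 <= 2 * nc w * nc z by rewrite !mulr_ge0.
apply: le_trans (lerD (lerD (lexx _) (ler_wpM2l h1 le1)) (ler_wpM2l w0 le2)) _.
by rewrite -!mulrDl le_eqVlt; apply/orP; left; apply/eqP; rewrite /t; ring.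
Qed.

Lemma l1_prod_quad (w : nat -> R[i]) (r : seq nat) n :
  \sum_(k < n) nc (\prod_(i <- r) quad (w i))`_k <=
  expR (\sum_(i <- r) nc (w i) * (nc z + 1) ^+ 2).
Proof.
elim: r => [|i r IHr].
  rewrite !big_nil expR0; case: n => [|n]; first by rewrite big_ord0.
  rewrite big_ord_recl coef1 Normc.normc1 big1 ?addr0 // => k _.
  by rewrite coef1 Normc.normc0.
rewrite !big_cons expRD; apply: le_trans (l1_quadM _ _ _) _.
apply: ler_pM => //.
- by rewrite addr_ge0 // mulr_ge0 ?normc_ge0 ?exprn_ge0 ?addr_ge0 ?normc_ge0.
- by apply: sumr_ge0 => k _; apply: normc_ge0.
- exact: expR_ge1Dx.
Qed.

Lemma tail_bound K N k : (0 < K)%N ->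
  nc (\prod_(K <= i < N) quad (b N i))`_k <= expR (M / K%:R * (nc z + 1) ^+ 2).
Proof.
move=> K0; apply: (@le_trans _ _
    (\sum_(j < k.+1) nc (\prod_(K <= i < N) quad (b N i))`_j)).
  by rewrite big_ord_recr /= lerDr; apply: sumr_ge0 => j _; apply: normc_ge0.
apply: le_trans (l1_prod_quad _ _ _) _; rewrite ler_expR -mulr_suml.
rewrite ler_wpM2r ?exprn_ge0 ?addr_ge0 ?normc_ge0 //.
by apply: (sum_bound_tail (t := fun i => nc (b N i))).
Qed.

(** The constant coefficient is the value of the tail at [z]. Weierstrass's product inequality
    bounds it below uniformly in [N], so the limit of the tail does not vanish at [z]. *)
Lemma tail_coef0_ge K N : (0 < K)%N -> M * nc z ^+ 2 / K%:R <= 2^-1 ->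
  2^-1 <= nc (\prod_(K <= i < N) quad (b N i))`_0.
Proof.
move=> K0 leK; rewrite -horner_coef0 horner_prod normc_prod.
pose t i := nc (b N i) * nc z ^+ 2.
have Mz0 : 0 <= M * nc z ^+ 2 by rewrite mulr_ge0 // exprn_ge0 // normc_ge0.
have le_t i : t i <= M * nc z ^+ 2 / i.+1%:R ^+ 2.
  by rewrite mulrAC ler_wpM2r ?exprn_ge0 ?normc_ge0.
have t01 i : (K <= i)%N -> 0 <= t i <= 1.
  move=> le_Ki; rewrite mulr_ge0 ?exprn_ge0 ?normc_ge0 //=.
  apply: le_trans (le_t i) _; apply: (@le_trans _ _ (M * nc z ^+ 2 / K%:R)).
    rewrite ler_wpM2l // lef_pV2 ?posrE ?exprn_gt0 ?ltr0n // -natrX ler_nat.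
    by rewrite (leq_trans le_Ki) // (leq_trans (leqnSn i)) // -[i.+1 in leqLHS]expn1 leq_pexp2l.
  by apply: le_trans leK _; rewrite invf_le1 // ler1n.
apply: (@le_trans _ _ (1 - \sum_(K <= i < N) t i)).
  have := @sum_bound_tail t _ K N Mz0 K0 le_t.
  by move: (\sum_(_ <= _ < _) _) => S leS; move: (le_trans leS leK); lra.
apply: le_trans (prod_1B_ge _ t01) _.
rewrite big_nat [leRHS]big_nat; apply: ler_prod => i /andP[le_Ki _].
have /andP[_ t1] := t01 i le_Ki; rewrite subr_ge0 t1 /=.
have -> : (quad (b N i)).[0] = 1 - b N i * z ^+ 2 by rewrite /quad !hornerE ?add0r.
rewrite lerBlDr -Normc.normc1 -{1}[1](subrK (b N i * z ^+ 2)).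
by apply: le_trans (ler_normcD _ _) _; rewrite lerD2l Normc.normcM normcX.
Qed.

Let a n : R[i] := if odd n then 0 else c n./2.

Lemma poly_comp_sqr N :
  (\poly_(k < N.+1) c k) \Po 'X^2 = \poly_(n < 2 * N.+1) a n.
Proof.
apply/polyP => n; rewrite poly_def raddf_sum coef_sum coef_poly /=.
under eq_bigr do rewrite linearZ /= comp_Xn_poly -exprM coefZ coefXn.
have [on|en] := boolP (odd n).
  rewrite /a on if_same big1 // => i _.
  case: eqP => [ni|_]; last by rewrite mulr0.
  by move: on; rewrite ni oddM.
have n2 : n = (2 * n./2)%N by rewrite mul2n even_halfK.
case: ltnP => [lt_n|le_n].
  have lt_n2 : (n./2 < N.+1)%N by lia.
  rewrite (bigD1 (Ordinal lt_n2)) //= -n2 eqxx mulr1 big1 ?addr0 /a ?(negPf en) // => i ni.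
  case: eqP => [e|_]; last by rewrite mulr0.
  by case/eqP: ni; apply: val_inj => /=; lia.
rewrite big1 // => i _; case: eqP => [e|_]; last by rewrite mulr0.
by have := ltn_ord i; lia.
Qed.

Lemma derive1n_limit K : (0 < K)%N -> M * nc z ^+ 2 / K%:R <= 2^-1 -> entire a ->
  exists2 d : nat -> R[i], d 0%N != 0 &
  forall j, derive1n j (ps a) z =
    conv (fun k => (\prod_(i < K) quad (beta i))`_k) d j *+ j`!.
Proof.
move=> K0 leK ent_a.
(* The tail may have no limit along [\oo], but its coefficients are bounded in [N] and hence
   converge along [U]; [d] collects the limits. *)
pose D N := \prod_(K <= i < N) quad (b N i).
have /choice[d cvd] : forall k, exists l : R[i]^o, ((D N)`_k : R[i]^o) @[N --> U] --> l.
  by move=> k; apply: ultra_bounded_cvg => N; apply: tail_bound.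
exists d.
  rewrite -normc_eq0 gt_eqF // (@lt_le_trans _ _ 2^-1) ?invr_gt0 //.
  by apply: (cvgc_lower_bound (@cvd 0%N)); apply: nearW => N; apply: tail_coef0_ge.
move=> j; apply: (@cvgc_unique R _ U _ (fun N =>
    ((\prod_(i < K) quad (b N i) * D N)`_j *+ j`! : R[i]^o))); last first.
  apply: cvgcMn.
  by apply: cvg_coef_prod => k; [apply: cvg_coef_head | apply: cvd].
have cv := @cvg_derivn_poly R a j z ent_a.
have cv2 : (((\poly_(n < 2 * N.+1) a n)^`(j)).[z] : R[i]^o) @[N --> \oo] -->
    (derive1n j (ps a) z : R[i]^o).
  have cvN : (2 * N.+1)%N @[N --> \oo] --> \oo.
    by apply/cvgnyPge => m; exists m => // N /= le_mN; lia.
  exact: (cvg_comp _ _ cvN cv).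
have cv3 := cvg_oo_ultra cv2.
apply: cvg_trans cv3; apply: near_eq_cvg.
have : U [set N | (K <= N)%N] by apply: sub_U; exists K.
apply: filterS => N /= le_KN.
rewrite -poly_comp_sqr -coef_comp_shift -comp_polyA comp_Xn_poly b_prod.
by rewrite comp_prod_linear -!(big_mkord xpredT (fun i => quad (b N i))) -big_cat_nat.
Qed.

(** The Taylor expansion at [z] is ['X^(nzeros K)] times a series whose constant term is a product
    of two nonzero numbers, one from the head and one from the tail. *)
Lemma order_limit K : (0 < K)%N -> M * nc z ^+ 2 / K%:R <= 2^-1 -> entire a ->
  (forall i, (i < nzeros K)%N -> derive1n i (ps a) z = 0) /\
  derive1n (nzeros K) (ps a) z != 0.
Proof.
move=> K0 leK ent_a; have [d d0 Ed] := derive1n_limit K0 leK ent_a.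
have [q Eq q0] := head_valuation K.
have low i : (i < nzeros K)%N -> (\prod_(i < K) quad (beta i))`_i = 0.
  by move=> lt_i; rewrite Eq coefXnM lt_i.
split=> [i lt_i|].
  rewrite Ed /conv big1 ?mul0rn // => k _.
  by rewrite low ?mul0r // (leq_ltn_trans _ lt_i) // -ltnS.
rewrite Ed /conv big_ord_recr /= subnn big1 ?add0r => [|k _]; last by rewrite low ?mul0r.
rewrite Eq coefXnM ltnn subnn mulrn_eq0 negb_or mulf_neq0 // andbT.
by rewrite -lt0n fact_gt0.
Qed.

End Order.
End UltraLimit.

(** * The Rayleigh sums *)

Section UnorderedSum.
Variable R : realType.
Local Notation nc := (@Normc.normc R).

Lemma has_unordered_sum_unique (I : choiceType) (A : set I) (F : I -> R[i]) s s' :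
  has_unordered_sum A F s -> has_unordered_sum A F s' -> s = s'.
Proof.
move=> Hs Hs'; apply/eqP; rewrite -subr_eq0 -normc_eq0; apply/eqP/le_anti.
rewrite normc_ge0 andbT; apply/ler_addgt0Pr => e e0; rewrite add0r.
have e20 : 0 < e / 2 by rewrite divr_gt0.
have [S0 S0A HS0] := Hs _ e20; have [S1 S1A HS1] := Hs' _ e20.
have SA : [set` (S0 `|` S1)%fset] `<=` A.
  by move=> z /=; rewrite in_fsetU => /orP[/S0A|/S1A].
have := HS0 _ (fsubsetUl _ _) SA; have := HS1 _ (fsubsetUr _ _) SA.
set t := \sum_(i <- _) _; rewrite !normcE !ltcR => lt1 lt0.
have -> : s - s' = (t - s') - (t - s) by ring.
by apply: le_trans (ler_normcB _ _) _; rewrite [e]splitr lerD // ltW.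
Qed.

Lemma unordered_sumE (I : choiceType) (A : set I) (F : I -> R[i]) s :
  has_unordered_sum A F s -> unordered_sum A F = s.
Proof.
by move=> Hs; apply: (has_unordered_sum_unique _ Hs); apply: (xgetI 0 Hs).
Qed.

(* [x i true] and [x i false] list the reciprocals of the points of [A], [ord]
   being the multiplicity in this list. *)
Lemma has_unordered_sum_zeros (A : set R[i]) (ord : R[i] -> nat)
    (x : nat -> bool -> R[i]) (m : nat) (s : R[i]) (B : R) :
  (0 < m)%N -> ~ A 0 ->
  (forall z, A z -> exists K0, forall K, (K0 <= K)%N ->
    ord z = (\sum_(i < K) \sum_(e : bool) (x i e * z == 1)%R)%N) ->
  (forall i e, x i e != 0 -> A (x i e)^-1) ->
  (forall K N, (0 < K)%N ->
    \sum_(K <= i < N) \sum_(e : bool) nc (x i e ^+ m) <= B / K%:R) ->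
  (forall K, (0 < K)%N ->
    nc (\sum_(i < K) \sum_(e : bool) x i e ^+ m - s) <= B / K%:R) ->
  has_unordered_sum A (fun z => z ^- m *+ ord z) s.
Proof.
move=> m0 nA0 ordE xA tailB limB e e0.
have B0 : 0 <= B.
  by have := le_trans (normc_ge0 _) (limB 1%N isT); rewrite divr1.
(* Half of [e] pays for the head error and half for the tail; the successor keeps [K] positive. *)
pose K := (Num.bound (2 * B / e)).+1.
have ltK : 2 * B / e < K%:R.
  apply: lt_le_trans (archi_boundP _) _; first by rewrite divr_ge0 ?mulr_ge0 // ltW.
  by rewrite ler_nat.
have BK : B / K%:R + B / K%:R < e.
  rewrite -mulrDl ltr_pdivrMr ?ltr0n // -ltr_pdivrMl //.
  by move: ltK; congr (_ < _); rewrite mulrC; congr (_ * _); rewrite mulr_natl mulr2n.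
pose s0 := [seq (x p.1 p.2)^-1 | p <- [seq (i, b) | i <- iota 0 K, b <- [:: true; false]]
  & x p.1 p.2 != 0].
have s0P z : z \in s0 -> A z by move=> /mapP[p]; rewrite mem_filter => /andP[/xA ? _] ->.
exists (seq_fset tt s0); first by move=> z zs; apply: s0P; rewrite -(seq_fsetE tt).
move=> S sub SA.
have /choice[f Hf] : forall z, exists k, A z -> forall N, (k <= N)%N ->
    ord z = (\sum_(i < N) \sum_(e : bool) (x i e * z == 1)%R)%N.
  by move=> z; have [/ordE[k Hk]|nAz] := pselect (A z); [exists k | exists 0%N].
(* Only finitely many points lie in [S], so one [N] captures the multiplicities of all of them. *)
pose N := maxn K (\max_(z <- S) f z).
have fN z : z \in S -> (f z <= N)%N.
  by move=> zS; rewrite leq_max; apply/orP; right; apply: leq_bigmax_seq.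
have le_KN : (K <= N)%N by apply: leq_maxl.
(* Summing over [S] keeps exactly the listed reciprocals whose inverse lies in [S]. Those of index
   below [K] are all kept, since [S] contains the inverses of the nonzero ones. *)
pose y i b := if (x i b)^-1 \in S then x i b ^+ m else 0.
have inner i b : \sum_(z <- S) (z ^- m *+ (x i b * z == 1)%R) = y i b.
  have [x0|x0] := eqVneq (x i b) 0.
    rewrite big1 => [|z _]; last by rewrite x0 mul0r eq_sym oner_eq0.
    by rewrite /y x0 expr0n gtn_eqF // if_same.
  rewrite (eq_bigr (fun z => if z == (x i b)^-1 then x i b ^+ m else 0)); last first.
    move=> z _; rewrite -(inj_eq (mulfI x0) z) divff //.
    case: eqP => [E|_]; last by rewrite mulr0n.
    have -> : z = (x i b)^-1 by apply: (mulfI x0); rewrite E divff.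
    by rewrite mulr1n exprVn invrK.
  rewrite /y; case: ifPn => [xS|xS].
    rewrite (bigD1_seq _ xS) ?fset_uniq //= eqxx big1 ?addr0 // => z zx.
    by rewrite (negPf zx).
  by rewrite big_seq big1 // => z zS; case: eqP => // zx; rewrite -zx zS in xS.
have total : \sum_(z <- S) z ^- m *+ ord z = \sum_(i < N) \sum_(b : bool) y i b.
  rewrite big_seq (eq_bigr (fun z =>
    \sum_(i < N) \sum_(b : bool) (z ^- m *+ (x i b * z == 1)%R))); last first.
    move=> z zS; rewrite (Hf z (SA _ zS) N (fN z zS)) -sumrMnr; apply: eq_bigr => i _.
    by rewrite -sumrMnr.
  rewrite -big_seq exchange_big; apply: eq_bigr => i _.
  by rewrite exchange_big; apply: eq_bigr => b _; apply: inner.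
have headE : \sum_(0 <= i < K) \sum_(b : bool) y i b =
    \sum_(i < K) \sum_(b : bool) x i b ^+ m.
  rewrite big_mkord; apply: eq_bigr => i _; apply: eq_bigr => b _.
  rewrite /y; case: ifPn => // nS; have [->|x0] := eqVneq (x i b) 0.
    by rewrite expr0n gtn_eqF.
  case/negP: nS; apply: (fsubsetP sub); rewrite seq_fsetE; apply/mapP; exists (nat_of_ord i, b) => //.
  rewrite mem_filter; apply/andP; split; first exact: x0.
  apply/allpairsP; exists (nat_of_ord i, b).
  by split=> //; [rewrite mem_iota /= add0n | case: b {x0}].
rewrite total normcE ltcR -(big_mkord xpredT (fun i => \sum_(b : bool) y i b)).
rewrite (big_cat_nat (n := K)) //= headE addrAC.
apply: le_lt_trans BK; apply: le_trans (ler_normcD _ _) _; apply: lerD.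
  exact: limB.
apply: le_trans (ler_normc_sum _ _ _) (le_trans _ (tailB K N isT)).
apply: ler_sum => i _; apply: le_trans (ler_normc_sum _ _ _) _; apply: ler_sum => b _.
by rewrite /y; case: ifP => // _; rewrite Normc.normc0 normc_ge0.
Qed.

End UnorderedSum.

(** The index of the first nonzero derivative is unique, so the choice made by [xget] is forced. *)
Lemma order_of_zero_eq (R : realType) (f : R[i] -> R[i]^o) z n :
  (forall i, (i < n)%N -> derive1n i f z = 0) -> derive1n n f z <> 0 ->
  order_of_zero f z = n.
Proof.
move=> low nz; have [low' nz'] : [set m | (forall i, (i < m)%N ->
    derive1n i f z = 0) /\ derive1n m f z <> 0] (order_of_zero f z).
  exact: (xgetI 0%N (conj low nz)).
move: (order_of_zero _ _) low' nz' => m low' nz'.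
have [lt_mn|lt_nm|//] := ltngtP m n; first by case: nz'; apply: low.
by case: nz; apply: low'.
Qed.

(** * Coefficient bounds for [dbessel] and the sums over its zeros *)

Section DBesselZeros.
Variables (R : realType) (nu : R).
Hypothesis hnu : forall k : nat, nu <> - k%:R.
Local Notation nc := (@Normc.normc R).

Let c k : R[i] := (dbessel_coef nu k)%:C.
Let a n : R[i] := if odd n then 0 else c n./2.

(** Beyond [2 |nu|] the constant 1/2 works; the finitely many remaining [k] are handled by the
    nonvanishing of [nu + k]. *)
Lemma nuD_lower_bound : exists2 d : R, 0 < d & forall k, d * k%:R <= `|nu + k%:R|.
Proof.
have init n : exists2 d : R, 0 < d & forall k, (k <= n)%N -> d * k%:R <= `|nu + k%:R|.
  elim: n => [|n [d d0 Hd]].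
    by exists 1 => // k; rewrite leqn0 => /eqP ->; rewrite mulr0.
  have nu0 : 0 < `|nu + n.+1%:R| by rewrite normr_gt0 nuD_neq0.
  exists (Num.min d (`|nu + n.+1%:R| / n.+1%:R)).
    by rewrite lt_min d0 divr_gt0 // ltr0n.
  move=> k; rewrite leq_eqVlt => /predU1P[->|].
    by rewrite -ler_pdivlMr ?ltr0n // ge_min lexx orbT.
  rewrite ltnS => /Hd; apply: le_trans; rewrite ler_wpM2r // ge_min lexx.
  by [].
have [d d0 Hd] := init (Num.bound (2 * `|nu|)).
exists (Num.min d 2^-1); first by rewrite lt_min d0 /= invr_gt0.
move=> k; have [le_k|lt_k] := leqP k (Num.bound (2 * `|nu|)).
  by apply: le_trans (Hd k le_k); rewrite ler_wpM2r // ge_min lexx.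
apply: (@le_trans _ _ (2^-1 * k%:R)); first by rewrite ler_wpM2r // ge_min lexx orbT.
have lek : 2 * `|nu| < k%:R.
  apply: lt_trans (archi_boundP _) _; first by rewrite mulr_ge0.
  by rewrite ltr_nat.
have := lerB_normD k%:R nu; rewrite normr_nat [k%:R + nu]addrC.
by move: (`|nu|) (`|_ + _|) lek => x y; lra.
Qed.

Lemma pochhammer_lower_bound (d : R) k : 0 < d ->
  (forall k, d * k%:R <= `|nu + k%:R|) ->
  d ^+ k * k`!%:R <= `|pochhammer (nu + 1) k|.
Proof.
move=> d0 Hd; elim: k => [|k IHk].
  by rewrite /pochhammer big_ord0 expr0 fact0 mul1r normr1.
rewrite pochhammerS normrM factS natrM exprSr -addrA nat1r.
apply: le_trans (ler_pM _ _ IHk (Hd k.+1)); rewrite ?mulr_ge0 ?exprn_ge0 ?(ltW d0) //.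
by rewrite le_eqVlt; apply/orP; left; apply/eqP; ring.
Qed.

(** One factorial is explicit in the coefficient and the other comes from the Pochhammer symbol; the
    linear factor [nu + 2 k] is absorbed by [(|nu| + 2) * 2 ^+ k]. *)
Lemma dbessel_coef_bound : exists C A : R, [/\ 1 <= C, 0 < A &
  forall k, nc (c k) <= C * A ^+ k / k`!%:R ^+ 2].
Proof.
have [d d0 Hd] := nuD_lower_bound.
have nu0 : 0 < `|nu| by rewrite normr_gt0 nu_neq0.
exists ((`|nu| + 2) / `|nu|), (2 / (4 * d)); split.
- by rewrite ler_pdivlMr // mul1r lerDl.
- by rewrite divr_gt0 // mulr_gt0.
move=> k; rewrite /c normc_real dbessel_coefE // /bessel_coef.
rewrite !normrM !normfV !normrM !normrX normrN1 expr1n mul1r !normr_nat.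
have le1 : `|nu + (2 * k)%:R| <= (`|nu| + 2) * 2 ^+ k.
  apply: le_trans (ler_normD _ _) _; rewrite normr_nat natrM [leRHS]mulrDl lerD //.
    by rewrite ler_peMr // exprn_ege1 // ler1n.
  by rewrite ler_wpM2l // -natrX ler_nat ltnW // ltn_expl.
have le2 := pochhammer_lower_bound k d0 Hd.
have f0 : 0 < k`!%:R :> R by rewrite ltr0n fact_gt0.
have dk0 : 0 < d ^+ k * k`!%:R by rewrite mulr_gt0 // exprn_gt0.
have p0 : 0 < `|pochhammer (nu + 1) k| by apply: lt_le_trans le2.
have p4 : 0 < (4 : R) ^+ k by rewrite exprn_gt0.
apply: (@le_trans _ _ ((k`!%:R * 4 ^+ k * (d ^+ k * k`!%:R))^-1 *
   ((`|nu| + 2) * 2 ^+ k) / `|nu|)).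
  rewrite ler_wpM2r ?invr_ge0 //; apply: ler_pM => //.
  by rewrite lef_pV2 ?posrE ?(mulr_gt0 (mulr_gt0 f0 p4)) // ler_pM2l // mulr_gt0.
rewrite expr_div_n exprMn le_eqVlt; apply/orP; left; apply/eqP.
by field; rewrite !gt_eqF // exprn_gt0.
Qed.

Lemma entire_dbessel : entire a.
Proof.
have [C [A [C1 A0 Hc]]] := dbessel_coef_bound.
move=> r r0; exists (C * expR (A * r ^+ 2)) => n; rewrite /a.
have C0 : 0 <= C by apply: le_trans C1.
have Ar0 : 0 <= A * r ^+ 2 by rewrite mulr_ge0 ?ltW // exprn_gt0.
case: ifPn => [_|en]; first by rewrite Normc.normc0 mul0r mulr_ge0 // expR_ge0.
set k := n./2; have -> : n = (2 * k)%N by rewrite mul2n even_halfK.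
apply: le_trans (ler_wpM2r _ (Hc k)) _; first by rewrite exprn_ge0 // ltW.
have f0 : 0 < k`!%:R :> R by rewrite ltr0n fact_gt0.
have f1 : 1 <= k`!%:R :> R by rewrite ler1n fact_gt0.
apply: (@le_trans _ _ (C * ((A * r ^+ 2) ^+ k / k`!%:R))).
  rewrite -!mulrA ler_wpM2l // exprMn -exprM -mulrA ler_wpM2l ?exprn_ge0 ?(ltW A0) //.
  rewrite mulrC ler_wpM2l ?exprn_ge0 ?(ltW r0) // lef_pV2 ?posrE ?exprn_gt0 //.
  by rewrite expr2 ler_peMr // ltW.
rewrite ler_wpM2l //; apply: le_trans (sum_exp_coeff_le k.+1 Ar0).
rewrite big_ord_recr /= lerDr; apply: sumr_ge0 => i _.
by rewrite divr_ge0 // exprn_ge0.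
Qed.

Lemma dbessel_ps : dbessel nu = ps a.
Proof.
apply/funext => z; rewrite /dbessel.
have cv := psum_cvg (z := z) entire_dbessel.
have cvN : (2 * N)%N @[N --> \oo] --> \oo.
  by apply/cvgnyPge => m; exists m => // N /= le_mN; lia.
have -> : series (fun k => (dbessel_coef nu k)%:C * z ^+ (2 * k) : R[i]^o) =
    (fun N => psum a z (2 * N)).
  apply/funext => N; rewrite /series /= /psum big_mkord.
  elim: N => [|N IHN]; first by rewrite !big_ord0.
  rewrite big_ord_recr /= IHN mulnS add2n !big_ord_recr /= -addrA; congr (_ + _).
  by rewrite /a mul2n /= odd_double /= doubleK mul0r addr0.
have cv2 : psum a z (2 * N) @[N --> \oo] --> ps a z by exact: (cvg_comp _ _ cvN cv).
by apply: (cvg_lim _ cv2); exact: norm_hausdorff.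
Qed.

Lemma conv_power_sumC k :
  conv (fun j => (power_sum nu j)%:C) c k = - (k.+1%:R * c k.+1).
Proof.
rewrite /c -(rmorph_nat (real_complex R)) -rmorphM -rmorphN.
have <- := conv_series_quo (fun k => - (k.+1%:R * dbessel_coef nu k.+1)) k (dbessel_coef0 hnu).
by rewrite /conv rmorph_sum; apply: eq_bigr => j _; rewrite [RHS]rmorphM.
Qed.

Lemma rayleighE l :
  rayleigh nu (l + 2) = (if odd l then 0 else 2 * power_sum nu l./2)%:C.
Proof.
have [C [A [C1 A0 Hc]]] := dbessel_coef_bound.
have c0 : c 0%N = 1 by rewrite /c dbessel_coef0.
have [b Hb] := truncation_roots c0 C1 A0 Hc.
move: (A * C * expR 1 ^+ 2) Hb => M Hb.
have b_prod N := (Hb N).1; have b_bound N := (Hb N).2.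
(* An ultrafilter finer than [\oo] makes all the root sequences converge at once, in place of a
   diagonal subsequence. *)
have [U [UU sub_U]] := @ultraFilterLemma nat \oo _.
have M0 : 0 <= M.
  by have := le_trans (normc_ge0 _) (b_bound 0%N 0%N); rewrite expr1n divr1.
have /choice[beta cvb] : forall i, exists l : R[i]^o, (b N i : R[i]^o) @[N --> U] --> l.
  move=> i; apply: (@ultra_bounded_cvg R _ U UU _ (M / i.+1%:R ^+ 2)) => N.
  exact: b_bound.
have beta_bound i := limit_root_bound UU b_bound cvb i.
have ordP z : exists K0, forall K, (K0 <= K)%N ->
    (forall i, (i < (\sum_(i < K) (beta i * z ^+ 2 == 1)%R)%N)%N ->
       derive1n i (ps a) z = 0) /\
    derive1n (\sum_(i < K) (beta i * z ^+ 2 == 1)%R)%N (ps a) z != 0.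
  have Mz0 : 0 <= 2 * (M * nc z ^+ 2) by rewrite !mulr_ge0 ?exprn_ge0 ?normc_ge0.
  exists (Num.bound (2 * (M * nc z ^+ 2))).+1 => K le_K.
  have K0 : (0 < K)%N by apply: leq_trans le_K.
  apply: (order_limit UU b_prod b_bound sub_U cvb K0 _ entire_dbessel).
  rewrite ler_pdivrMr ?ltr0n // -ler_pdivrMl ?invr_gt0 // invrK.
  apply: ltW (lt_le_trans (archi_boundP Mz0) _).
  by rewrite ler_nat ltnW.
have ordE z : exists K0, forall K, (K0 <= K)%N ->
    order_of_zero (dbessel nu) z = (\sum_(i < K) (beta i * z ^+ 2 == 1)%R)%N.
  have [K0 HK0] := ordP z; exists K0 => K /HK0; rewrite -dbessel_ps.
  set n := (\sum_(_ < _) _)%N => -[low nz].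
  by apply: order_of_zero_eq => //; apply/eqP.
have zeroP z : dbessel nu z = 0 <-> exists i, beta i * z ^+ 2 = 1.
  have [K0 HK0] := ordP z; split=> [fz|[i bz]].
    have [//|nex] := pselect (exists i, beta i * z ^+ 2 = 1).
    have [_] := HK0 K0 (leqnn _); rewrite big1 => [|i _].
      by rewrite /= -dbessel_ps fz eqxx.
    by case: eqP => // bz; case: nex; exists i.
  have [low _] := HK0 _ (leq_maxl K0 i.+1).
  rewrite dbessel_ps; apply: (low 0%N).
  have lt_i : (i < maxn K0 i.+1)%N by rewrite leq_max ltnSn orbT.
  by rewrite (bigD1 (Ordinal lt_i)) //= bz eqxx.
(* A nonzero [beta i] stands for two opposite zeros, whose reciprocals are its two square roots. *)
pose x i (e : bool) : R[i] := if e then sqrtC (beta i) else - sqrtC (beta i).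
have x2 i e : x i e ^+ 2 = beta i.
  by rewrite /x; case: e; rewrite ?sqrrN sqrtCK.
(* The 2 counts the two signs; [1 + M] bounds a square root of [beta i], since
   [M <= (1 + M) ^+ 2]. *)
pose B := 2 * (M * (1 + M) ^+ l).
have xl_bound i e : nc (x i e ^+ (l + 2)) <= M * (1 + M) ^+ l / i.+1%:R ^+ 2.
  have nx : nc (x i e) <= 1 + M.
    rewrite -ler_sqr ?nnegrE ?normc_ge0 ?addr_ge0 // -normcX x2.
    apply: le_trans (beta_bound i) _; apply: (@le_trans _ _ M).
      by rewrite ler_pdivrMr ?exprn_gt0 ?ltr0n // ler_peMr // exprn_ege1 // ler1n.
    by rewrite expr2; move: M0; generalize M => t t0; nra.
  rewrite exprD Normc.normcM x2 mulrC mulrAC; apply: ler_pM; rewrite ?normc_ge0 //.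
  by rewrite normcX lerXn2r ?nnegrE ?normc_ge0 ?addr_ge0.
apply: unordered_sumE; apply: (@has_unordered_sum_zeros _ _ _ x _ _ B).
- by rewrite addn2.
- by move=> /= /zeroP[j]; rewrite expr0n mulr0 => /esym/eqP; rewrite oner_eq0.
- move=> z _; have [K0 HK0] := ordE z; exists K0 => K /HK0 ->.
  (* With [t] the product of [z] and a square root of [beta i], [t ^+ 2 = 1] means [t = 1] or
     [t = -1], and never both, so multiplicities agree. *)
  apply: eq_bigr => i _; rewrite big_bool /= mulNr.
  rewrite -[in LHS](x2 i true) -exprMn sqrf_eq1 /=.
  set t := sqrtC _ * z; rewrite [- t == 1]eqr_oppLR.
  have [->|_] //= := eqVneq t 1.
  by rewrite -addr_eq0 -[1 + 1]/(2%:R) pnatr_eq0.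
- move=> i e x0; apply/zeroP; exists i.
  by rewrite -(x2 i e) exprVn divff // expf_neq0.
- move=> K N K0; rewrite (eq_bigr (fun i => nc (x i true ^+ (l + 2)) +
    nc (x i false ^+ (l + 2)))); last by move=> i _; rewrite big_bool.
  apply: (sum_bound_tail (B := B)) => // [|i].
    by rewrite !mulr_ge0 ?exprn_ge0 ?addr_ge0.
  by rewrite /B mulr_natl mulrnAl mulr2n lerD.
move=> K K0.
(* Opposite reciprocals cancel in odd powers and double in even ones, where
   [l + 2 = 2 * (l./2).+1]. *)
have -> : \sum_(i < K) \sum_(e : bool) x i e ^+ (l + 2) =
    if odd l then 0 else 2 * \sum_(i < K) beta i ^+ (l./2).+1.
  have E i : \sum_(e : bool) x i e ^+ (l + 2) =
      if odd l then 0 else 2 * beta i ^+ (l./2).+1.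
    rewrite big_bool /x /= exprNn -signr_odd oddD addbF.
    case: ifPn => ol; first by rewrite expr1 mulN1r subrr.
    rewrite expr0 mul1r -mulr2n -[LHS]mulr_natl -[in RHS](sqrtCK (beta i)) -exprM.
    congr (_ * _); congr (_ ^+ _).
    by rewrite mulnS mul2n even_halfK // addnC.
  under eq_bigr do rewrite E; case: (odd l); first by rewrite big1.
  by rewrite mulr_sumr.
have BK0 : 0 <= B / K%:R by rewrite divr_ge0 // !mulr_ge0 ?exprn_ge0 ?addr_ge0.
case: ifPn => [_|el]; first by rewrite subrr Normc.normc0.
rewrite rmorphM rmorph_nat -mulrBr Normc.normcM normc_nat.
apply: le_trans (ler_wpM2l _ (limit_root_power_sum UU c0 b_prod b_bound sub_U cvb _ K0 conv_power_sumC)) _ => //.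
rewrite /B [leLHS]mulrA ler_wpM2r ?invr_ge0 // ler_wpM2l // exprS ler_wpM2l //.
apply: (@le_trans _ _ ((1 + M) ^+ l./2)).
  by rewrite lerXn2r ?nnegrE ?addr_ge0 // lerDr.
rewrite ler_weXn2l // ?lerDl //; lia.
Qed.

End DBesselZeros.

Theorem theorem3p3 (R : realType) (nu : R)
    (hnu : forall k : nat, nu <> - k%:R) (n : nat) (hn : (1 <= n)%N) :
  hankel_det nu n =
    (nu ^+ 2 * (q_poly nu n.+1).[1 / nu] * (q_poly nu n.+2).[1 / nu] /
     (2 ^ ((n ^ 2)%:Z - 2) *
      \prod_(1 <= i < n.+1) (nu + i%:R) ^+ (2 * (n - i) + 1)))%:C.
Proof.
rewrite -det_power_sum // -det_map_mx; congr (\det _).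
by apply/matrixP => i j; rewrite !mxE rayleighE.
Qed.
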